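(* Let $d\geq 2$, $p\in\mathbb{N}\cup\{\infty\}$, and let $f:\mathbb{R}^d\to\mathbb{R}$ be a $C^p$ convex function which is not of class $C^{p+1}$. The following statements are equivalent: (1) $f$ is properly convex. (2) $f$ can be written in the form $f=\ell+c$, where $\ell$ is linear and $\lim_{|x|\to\infty}c(x)=\infty$. (3) $f$ cannot be written in the form $f=c\circ P+\ell$, where $P:\mathbb{R}^d\to\mathbb{R}^k$ is a linear projection, $k<d$, $c:\mathbb{R}^k\to\mathbb{R}$ is convex, and $\ell:\mathbb{R}^d\to\mathbb{R}$ is linear. (4) $f$ can be approximated by strongly convex real analytic functions in the $C^0$-fine topology. (5) $f$ can be approximated by $C^{p+1}$ convex functions in the $C^0$-fine topology.
   Context: $C^{\infty+1}$ means real analytic. Properly convex: for $U\subseteq\mathbb{R}^d$ open and convex, $f:U\to\mathbb{R}$ is properly convex if $f=\ell+c$, where $\ell$ is linear and $c:U\to[a,b)$, with $-\infty<a<b\leq\infty$, is convex and proper, meaning that $c^{-1}([a,\beta])$ is compact for every $\beta\in[a,b)$. $f$ can be approximated by functions of a class in the $C^0$-fine topology if for every continuous $\varepsilon:\mathbb{R}^d\to(0,\infty)$ there is $g:\mathbb{R}^d\to\mathbb{R}$ in the class with $|f(x)-g(x)|\leq\varepsilon(x)$ for all $x\in\mathbb{R}^d$. A $C^2$ function on $\mathbb{R}^d$ is strongly convex if its second derivative along every nonconstant straight line is strictly positive at every point. A linear projection $P:\mathbb{R}^d\to\mathbb{R}^k$ is a surjective linear map. *)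

(* Defs.v *)
(* R^d is the normed module of row vectors 'rV[R]_d over
   R : realType. Its norm is the sup norm, equivalent to the Euclidean one. *)
From mathcomp Require Import all_boot all_order all_algebra.
From mathcomp Require Import all_classical all_reals.
From mathcomp Require Import ereal topology normedtype convex esum numfun derive.

Set Implicit Arguments.
Unset Strict Implicit.
Unset Printing Implicit Defensive.

Import Order.TTheory GRing.Theory Num.Theory.
Import numFieldNormedType.Exports.

Local Open Scope classical_set_scope.
Local Open Scope ring_scope.

(* The exponents p in N + {oo}; N contains 0, and C^0 means continuous. *)
Inductive exponent := Finite of nat | Infinite.

Section regularity.
Context {R : realType} {d : nat}.
Implicit Types f : 'rV[R]_d -> R.

(* All partial derivatives of order at most n exist and are continuous. *)
Fixpoint C_n (n : nat) f : Prop :=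
  continuous f /\
  match n with
  | 0%N => True
  | n'.+1 => forall i : 'I_d,
      (forall x, derivable f x (delta_mx 0 i)) /\
      C_n n' ('D_(delta_mx 0 i) f)
  end.

(* The family u is absolutely summable, with sum s. *)
Definition has_sum (I : choiceType) (u : I -> R) (s : R) : Prop :=
  let v : I -> \bar R := EFin \o u in
  summable setT v /\
  (\esum_(i in setT) v^\+ i - \esum_(i in setT) v^\- i = s%:E)%E.

(* Near each point a, f is the sum of a power series in x - a; the
   multi-indices are the finite functions alpha : 'I_d -> nat. *)
Definition real_analytic f : Prop :=
  forall a : 'rV[R]_d, exists coef : {ffun 'I_d -> nat} -> R,
    nbhs a [set x : 'rV[R]_d |
      has_sum (fun alpha : {ffun 'I_d -> nat} =>
                 coef alpha * \prod_(i < d) (x 0 i - a 0 i) ^+ alpha i)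
              (f x)].

Definition of_class (p : exponent) f : Prop :=
  match p with
  | Finite n => C_n n f
  | Infinite => forall n, C_n n f
  end.

(* The class C^{p+1}, where C^{oo+1} means real analytic. *)
Definition of_class_succ (p : exponent) f : Prop :=
  match p with
  | Finite n => C_n n.+1 f
  | Infinite => real_analytic f
  end.

Definition strongly_convex f : Prop :=
  C_n 2 f /\
  forall x v : 'rV[R]_d, v != 0 ->
    forall t : R, 0 < derive1n 2 (fun s : R => f (x + s *: v)) t.

(* U is meant to be open and convex; only the values of c on U matter. *)
Definition properly_convex (U : set 'rV[R]_d) f : Prop :=
  exists (l : {scalar 'rV[R]_d}) (c : 'rV[R]_d -> R) (a : R) (b : \bar R),
    [/\ (a%:E < b)%E,
        forall x, U x -> f x = l x + c x,
        forall x, U x -> a <= c x /\ ((c x)%:E < b)%E,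
        convex_function U c
      & forall beta : R, a <= beta -> (beta%:E < b)%E ->
          compact (U `&` c @^-1` [set y | a <= y <= beta])].

Definition C0_fine_approximable f (class : set ('rV[R]_d -> R)) : Prop :=
  forall eps : 'rV[R]_d -> R, continuous eps -> (forall x, 0 < eps x) ->
    exists2 g, class g & forall x, `|f x - g x| <= eps x.

(* The filter |x| -> oo. *)
Definition norm_infty : set_system 'rV[R]_d :=
  filter_from [set: R] (fun r => [set x : 'rV[R]_d | r < `|x|]).

End regularity.

(* Main.v *)
(* Everything rests on (3) -> (4). If f is affine along no direction, then its
   subgradients span affinely, and subtracting the mean of finitely many of them
   makes f coercive. For a coercive convex c, choose countably many affine
   functions L_i and sharpness parameters lam_i -> oo, and let g be the solution
   of

     sum_i exp (lam_i (L_i x - g x)) = 1.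

   The left-hand side is convex in (x, t = g x) and decreasing in t, so g is
   convex; g >= sup_i L_i because each term is at most 1, and the lam_i make g
   as close to sup_i L_i as desired. The L_i are tilted support planes of c,
   arranged so that c < sup_i L_i <= c + eps and so that, on each bounded set,
   all but finitely many L_i stay below g by a fixed amount. This gap makes the
   series converge on complex neighbourhoods, and g is analytic by an implicit
   function theorem, proved by iteration in an algebra of absolutely convergent
   power series; no smoothness of c is needed.

   For (5) -> (1), a convex g with g - f -> 0 along the lines on which f is
   affine equals f. *)
Require Import Defs.
From HB Require Import structures.
From mathcomp Require Import all_boot all_order all_algebra.
From mathcomp Require Import all_classical all_reals.
From mathcomp Require Import ereal topology normedtype convex esum numfun derive.
From mathcomp Require Import sequences realfun exp interval_inference.
From mathcomp Require Import ring lra.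

Set Implicit Arguments.
Unset Strict Implicit.
Unset Printing Implicit Defensive.

Import Order.TTheory GRing.Theory Num.Theory.
Import numFieldNormedType.Exports.

Local Open Scope classical_set_scope.
Local Open Scope ring_scope.

(** * Unconditional sums *)

Section psum.
Context {R : realType}.

(** The tolerance [eps] may decay arbitrarily fast, so no convolution with a fixed kernel can work,
    and analytic functions cannot be glued: one formula has to adapt its accuracy to the position.
    The usual soft maximum, the logarithm of [sum_i expR (lam * L_i)] divided by [lam], has the same
    sharpness for all planes; passing to an implicit equation lets each plane carry its own [lam_i]
    and still leaves [g] convex. The price is that the [lam_i] and the slopes are unbounded, so no
    radius of convergence is uniform. Analyticity at [a] is reduced to one summability condition:
    the terms of the equation at [a], each enlarged by the factor [expR (rho * (lam_i + |zeta_i|))],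
    must remain summable for some [rho > 0] that depends on [a]. The strict inequality between the
    function and [g] is what provides this [rho], and the same condition serves existence,
    analyticity and strong convexity. *)

Definition psum (I : choiceType) (p : I -> R) (P : R) : Prop :=
  (forall i, 0 <= p i) /\ (\esum_(i in [set: I]) (p i)%:E = P%:E)%E.

Lemma psum_ge0 (I : choiceType) (p : I -> R) P : psum p P -> 0 <= P.
Proof.
by move=> [p0 pP]; rewrite -lee_fin -pP; apply: esum_ge0 => i _; rewrite lee_fin.
Qed.

Lemma psum_unique (I : choiceType) (p : I -> R) P Q :
  psum p P -> psum p Q -> P = Q.
Proof. by move=> [_ pP] [_]; rewrite pP => -[]. Qed.

Lemma psum_ext (I : choiceType) (p q : I -> R) P :
  p =1 q -> psum p P -> psum q P.
Proof. by move=> /funext ->. Qed.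

Lemma psum_dom (I : choiceType) (p q : I -> R) Q :
  (forall i, 0 <= p i <= q i) -> psum q Q -> exists2 P, psum p P & P <= Q.
Proof.
move=> pq [q0 qQ].
have p0 i : 0 <= p i by case/andP: (pq i).
have le : (\esum_(i in [set: I]) (p i)%:E <= Q%:E)%E.
  by rewrite -qQ; apply: le_esum => i _; rewrite lee_fin; case/andP: (pq i).
have ge : (0 <= \esum_(i in [set: I]) (p i)%:E)%E.
  by apply: esum_ge0 => i _; rewrite lee_fin.
have fn : (\esum_(i in [set: I]) (p i)%:E)%E \is a fin_num.
  by rewrite ge0_fin_numE// (le_lt_trans le)// ltry.
exists (fine (\esum_(i in [set: I]) (p i)%:E)%E); last first.
  by rewrite -lee_fin fineK.
by split => //; rewrite fineK.
Qed.

Lemma psumD (I : choiceType) (p q : I -> R) P Q :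
  psum p P -> psum q Q -> psum (fun i => p i + q i) (P + Q).
Proof.
move=> [p0 pP] [q0 qQ]; split; first by move=> i; apply: addr_ge0.
rewrite EFinD -pP -qQ -esumD; last 2 first.
- by move=> i _; rewrite lee_fin.
- by move=> i _; rewrite lee_fin.
by apply: eq_esum => i _; rewrite EFinD.
Qed.

Lemma psum_le (I : choiceType) (p q : I -> R) P Q :
  (forall i, p i <= q i) -> psum p P -> psum q Q -> P <= Q.
Proof.
move=> pq pP [q0 qQ]; rewrite -lee_fin -qQ; case: pP => p0 <-.
by apply: le_esum => i _; rewrite lee_fin.
Qed.

Lemma psum_reindex (I J : choiceType) (h : I -> J) (h' : J -> I) (p : J -> R) P :
  cancel h h' -> cancel h' h -> psum p P -> psum (fun i => p (h i)) P.
Proof.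
move=> hK h'K [p0 pP]; split => //; rewrite -pP; apply/esym.
apply: (@reindex_esum _ _ _ [set: I] [set: J] h (fun j => (p j)%:E)).
split => //; first by move=> x y _ _; exact: (can_inj hK).
by move=> j _; exists (h' j).
Qed.

Lemma psum_pair (I J : choiceType) (p : I * J -> R) (c : I -> R) P :
  (forall i, psum (fun j => p (i, j)) (c i)) -> psum c P <-> psum p P.
Proof.
move=> pc; have p0 k : 0 <= p k by case: k => i j; case: (pc i).
have E : (\esum_(i in [set: I]) (c i)%:E = \esum_(k in [set: I * J]) (p k)%:E)%E.
  transitivity (\esum_(i in [set: I]) \esum_(j in [set: J]) (p (i, j))%:E)%E.
    by apply: eq_esum => i _; case: (pc i) => _ ->.
  rewrite (@esum_esum _ _ _ [set: I] (fun=> [set: J]) (fun i j => (p (i, j))%:E)).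
    have -> : [set: I] `*`` (fun=> [set: J]) = [set: I * J].
      by apply/seteqP; split.
    by apply: eq_esum => -[i j].
  by move=> i j _ _; rewrite lee_fin.
split=> -[h e]; split => //; first by rewrite -E.
- by move=> i; exact: (psum_ge0 (pc i)).
- by rewrite E.
Qed.

Lemma psum1 (I : choiceType) (p : I -> R) (i0 : I) :
  0 <= p i0 -> (forall i, i != i0 -> p i = 0) -> psum p (p i0).
Proof.
move=> p0 pi; have pge i : 0 <= p i.
  by have [->//|/pi ->] := eqVneq i i0.
split => //; rewrite -(@esum_set1 _ _ i0 (fun i => (p i)%:E)) ?lee_fin//.
rewrite [RHS]esum_mkcond; apply: eq_esum => i _.
case: ifPn => //; rewrite notin_setE/= => /eqP /pi ->//.
Qed.

Lemma psum0 (I : choiceType) : psum (fun _ : I => 0) 0.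
Proof. by split => //; apply: esum1. Qed.

Lemma psum_fiber (I J : choiceType) (p : I * J -> R) P :
  psum p P -> exists2 c, (forall i, psum (fun j => p (i, j)) (c i)) & psum c P.
Proof.
(* The fibre over [i] is the whole family cut down by an indicator, hence summable by comparison. *)
move=> pP; have : forall i, exists x, psum (fun j => p (i, j)) x.
  move=> i; pose q (k : I * J) := if k.1 == i then p k else 0.
  have [|Q qQ _] := @psum_dom _ q p P _ pP.
    by case: pP => p0 _ k; rewrite /q; case: ifP; rewrite ?lexx p0.
  have [q0 qE] := qQ.
  exists Q; split; first by move=> j; case: pP.
  rewrite -qE.
  have E : (\esum_(j in [set: J]) (p (i, j))%:E =
      \esum_(k in pair i @` [set: J]) (p k)%:E)%E.
    by rewrite esum_image// => x y _ _ [].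
  rewrite E esum_mkcond; apply: eq_esum => -[a b] _ /=.
  rewrite /q/=; case: ifPn; rewrite ?inE ?notin_setE/=.
    by move=> [j _ [<- <-]]; rewrite eqxx.
  by move=> h; case: eqP => // ai; exfalso; apply: h; exists b; rewrite ?ai.
move=> /choice[c hc]; exists c => //; exact/(psum_pair P hc).
Qed.

Lemma psumZ (I : choiceType) (p : I -> R) P (k : R) :
  0 <= k -> psum p P -> psum (fun i => k * p i) (k * P).
Proof.
move=> k0 pP.
have := pP => -[p0 pE].
(* Only [<=] is proved on finite subsums; the reverse inequality is the same statement for
   [k^-1]. *)
suff le (k' : R) (q : I -> R) Q : 0 <= k' -> psum q Q ->
    (\esum_(i in [set: I]) (k' * q i)%:E <= (k' * Q)%:E)%E.
  split; first by move=> i; rewrite mulr_ge0.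
  apply/eqP; rewrite eq_le le//=.
  have [->|kn0] := eqVneq k 0.
    rewrite mul0r; apply: esum_ge0 => i _; rewrite mul0r//.
  have kp : 0 < k by rewrite lt_neqAle eq_sym kn0.
  have kQ : psum (fun i => k * p i) (fine (\esum_(i in [set: I]) (k * p i)%:E)%E).
    split; first by move=> i; rewrite mulr_ge0.
    rewrite fineK// ge0_fin_numE; last by apply: esum_ge0 => i _; rewrite lee_fin mulr_ge0.
    by rewrite (le_lt_trans (le _ _ _ k0 pP))// ltry.
  have := le k^-1 _ _ _ kQ; rewrite invr_ge0 => /(_ k0).
  under eq_esum do rewrite mulrA mulVf// mul1r.
  rewrite pE lee_fin ler_pdivlMl// => h.
  by have [_ ->] := kQ; rewrite lee_fin.
move=> k'0 qQ.
apply: ge_ereal_sup => _ [X [finX _] <-].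
rewrite fsbig_finite//=.
rewrite sumEFin -mulr_sumr lee_fin ler_wpM2l//.
rewrite -lee_fin; case: qQ => _ <-; apply: esum_ge; exists X; first by split.
by rewrite fsbig_finite//= sumEFin.
Qed.

End psum.

Section has_sum_theory.
Context {R : realType}.

(** Signed families are handled as differences of two nonnegative ones, so that rearrangements
    reduce to facts about [esum]. *)
Lemma has_sum_psum (I : choiceType) (u p q : I -> R) P Q :
  psum p P -> psum q Q -> u =1 (fun i => p i - q i) -> has_sum u (P - Q).
Proof.
move=> [p0 pP] [q0 qQ] /funext ->.
have sm (f : I -> R) F : (forall i, 0 <= f i) ->
    (\esum_(i in [set: I]) (f i)%:E = F%:E)%E -> summable setT (EFin \o f).
  move=> f0 fF; rewrite /summable.
  under eq_esum do rewrite /= ger0_norm//.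
  by rewrite fF ltry.
have E : EFin \o (fun i => p i - q i) = ((EFin \o p) \- (EFin \o q))%E.
  by apply/funext => i; rewrite /= EFinB.
rewrite /has_sum E; split; first by apply: summableB; [exact: sm pP|exact: sm qQ].
rewrite (@esumB _ _ setT (EFin \o p) (EFin \o q)); last 4 first.
- exact: sm pP.
- exact: sm qQ.
- by move=> i _; rewrite /= lee_fin.
- by move=> i _; rewrite /= lee_fin.
by rewrite /= pP qQ -EFinB.
Qed.

Lemma has_sum_unique (I : choiceType) (u : I -> R) s s' :
  has_sum u s -> has_sum u s' -> s = s'.
Proof. by move=> [_ e] [_]; rewrite e => -[]. Qed.

Lemma has_sum_ext (I : choiceType) (u v : I -> R) s :
  u =1 v -> has_sum u s -> has_sum v s.
Proof. by move=> /funext ->. Qed.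

Lemma has_sum_abs (I : choiceType) (u : I -> R) s :
  has_sum u s -> exists M, psum (fun i => `|u i|) M.
Proof.
move=> [+ _]; rewrite summableE /= => fn.
exists (fine (\esum_(i in [set: I]) `|(u i)%:E|)%E); split => //.
by rewrite fineK.
Qed.

Lemma has_sum_psum_abs (I : choiceType) (u : I -> R) M :
  psum (fun i => `|u i|) M ->
  exists p q P Q, [/\ psum p P, psum q Q, u =1 (fun i => p i - q i),
    (forall i, `|u i| = p i + q i) & P + Q = M].
Proof.
move=> uM.
have [|P pP _] := @psum_dom _ _ (fun i => Num.max (u i) 0) _ _ _ uM.
  by move=> i /=; rewrite le_max lexx orbT/= ge_max ler_norm normr_ge0.
have [|Q qQ _] := @psum_dom _ _ (fun i => Num.max (- u i) 0) _ _ _ uM.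
  by move=> i /=; rewrite le_max lexx orbT/= ge_max normr_ge0 -normrN ler_norm.
have e i : `|u i| = Num.max (u i) 0 + Num.max (- u i) 0.
  rewrite !maxEle oppr_le0; case: (leP 0 (u i)) => h;
    [rewrite ger0_norm//|rewrite ltr0_norm//]; case: (leP (u i) 0) => h'; lra.
exists (fun i => Num.max (u i) 0), (fun i => Num.max (- u i) 0), P, Q; split => //.
  by move=> i /=; rewrite !maxEle oppr_le0; case: (leP 0 (u i)) => h;
    case: (leP (u i) 0) => h'; lra.
apply: psum_unique uM; apply: psum_ext (psumD pP qQ) => i; exact/esym.
Qed.

Lemma has_sum_ex (I : choiceType) (u : I -> R) M :
  psum (fun i => `|u i|) M -> exists2 s, has_sum u s & `|s| <= M.
Proof.
move=> /has_sum_psum_abs[p [q [P [Q [pP qQ upq _ <-]]]]].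
exists (P - Q); first exact: has_sum_psum pP qQ upq.
have := psum_ge0 pP; have := psum_ge0 qQ => Q0 P0.
by rewrite ler_norml; apply/andP; split; lra.
Qed.

Lemma has_sum_parts (I : choiceType) (u : I -> R) s : has_sum u s ->
  exists p q P Q, [/\ psum p P, psum q Q, u =1 (fun i => p i - q i) & s = P - Q].
Proof.
move=> us; have [M /has_sum_psum_abs[p [q [P [Q [pP qQ upq _ _]]]]]] := has_sum_abs us.
exists p, q, P, Q; split => //; apply: has_sum_unique us _; exact: has_sum_psum pP qQ upq.
Qed.

Lemma has_sum_of_psum (I : choiceType) (u : I -> R) s : psum u s -> has_sum u s.
Proof.
move=> us; rewrite -[s]subr0; apply: has_sum_psum us (psum0 I) _ => i.
by rewrite subr0.
Qed.

Lemma psum_of_has_sum (I : choiceType) (u : I -> R) s :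
  (forall i, 0 <= u i) -> has_sum u s -> psum u s.
Proof.
move=> u0 us; have [M uM] := has_sum_abs us.
have {}uM : psum u M by apply: psum_ext uM => i; rewrite ger0_norm.
by rewrite (has_sum_unique us (has_sum_of_psum uM)).
Qed.

Lemma has_sum_le_abs (I : choiceType) (u : I -> R) s M : has_sum u s ->
  psum (fun i => `|u i|) M -> `|s| <= M.
Proof. by move=> us /has_sum_ex[s' us' ?]; rewrite (has_sum_unique us us'). Qed.

Lemma has_sumD (I : choiceType) (u v : I -> R) s t :
  has_sum u s -> has_sum v t -> has_sum (fun i => u i + v i) (s + t).
Proof.
move=> /has_sum_parts[p [q [P [Q [pP qQ upq ->]]]]] /has_sum_parts[p' [q' [P' [Q' [pP' qQ' vpq ->]]]]].
have -> : P - Q + (P' - Q') = (P + P') - (Q + Q') by ring.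
by apply: has_sum_psum (psumD pP pP') (psumD qQ qQ') _ => i; rewrite upq vpq; ring.
Qed.

Lemma has_sumZ (I : choiceType) (u : I -> R) s k :
  has_sum u s -> has_sum (fun i => k * u i) (k * s).
Proof.
move=> /has_sum_parts[p [q [P [Q [pP qQ upq ->]]]]].
have [k0|k0] := leP 0 k.
  rewrite mulrBr.
  by apply: has_sum_psum (psumZ k0 pP) (psumZ k0 qQ) _ => i; rewrite upq mulrBr.
have {}k0 : 0 <= - k by lra.
have -> : k * (P - Q) = (- k * Q) - (- k * P) by ring.
by apply: has_sum_psum (psumZ k0 qQ) (psumZ k0 pP) _ => i; rewrite upq; ring.
Qed.

Lemma has_sumN (I : choiceType) (u : I -> R) s :
  has_sum u s -> has_sum (fun i => - u i) (- s).
Proof.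
by move=> /(has_sumZ (-1)); rewrite mulN1r; apply: has_sum_ext => i; rewrite mulN1r.
Qed.

Lemma has_sumB (I : choiceType) (u v : I -> R) s t :
  has_sum u s -> has_sum v t -> has_sum (fun i => u i - v i) (s - t).
Proof. by move=> us /has_sumN; exact: has_sumD us. Qed.

Lemma has_sum1 (I : choiceType) (u : I -> R) (i0 : I) :
  (forall i, i != i0 -> u i = 0) -> has_sum u (u i0).
Proof.
move=> ui; have h : psum (fun i => `|u i|) `|u i0|.
  by apply: (@psum1 _ _ (fun i => `|u i|)) => // i /ui ->; rewrite normr0.
have [s us _] := has_sum_ex h.
suff -> : u i0 = s by [].
have [u0|u0] := leP 0 (u i0).
  apply: has_sum_unique us; apply: has_sum_of_psum; apply: psum1 => //.
rewrite -[LHS]opprK -[RHS]opprK; congr (- _).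
apply: has_sum_unique (has_sumN us); apply: has_sum_of_psum.
by apply: (@psum1 _ _ (fun i => - u i)) => [|i /ui ->]; rewrite ?oppr0// oppr_ge0 ltW.
Qed.

Lemma has_sum_reindex (I J : choiceType) (h : I -> J) (h' : J -> I) (u : J -> R) s :
  cancel h h' -> cancel h' h -> has_sum u s -> has_sum (fun i => u (h i)) s.
Proof.
move=> hK h'K /has_sum_parts[p [q [P [Q [pP qQ upq ->]]]]].
apply: has_sum_psum (psum_reindex hK h'K pP) (psum_reindex hK h'K qQ) _ => i.
by rewrite upq.
Qed.

Lemma has_sum_fiber (I J : choiceType) (u : I * J -> R) M :
  psum (fun k => `|u k|) M ->
  exists c s N, [/\ forall i, has_sum (fun j => u (i, j)) (c i), has_sum c s,
    has_sum u s, psum (fun i => `|c i|) N & N <= M].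
Proof.
move=> uM.
have [p [q [P [Q [pP qQ upq uabs PQ]]]]] := has_sum_psum_abs uM.
have [a pa aP] := psum_fiber pP; have [b qb bQ] := psum_fiber qQ.
have [|N cN NM] := @psum_dom _ _ (fun i => `|a i - b i|) _ _ _ (psumD aP bQ).
  move=> i; rewrite normr_ge0 /=.
  have := psum_ge0 (pa i); have := psum_ge0 (qb i) => ? ?.
  by rewrite ler_norml; apply/andP; split; lra.
exists (fun i => a i - b i), (P - Q), N; split => //.
- move=> i; exact: has_sum_psum (pa i) (qb i) _.
- exact: has_sum_psum aP bQ _.
- exact: has_sum_psum pP qQ _.
- by rewrite -PQ.
Qed.

Lemma has_sum_fubini (I J : choiceType) (u : I * J -> R) M (c : I -> R) :
  psum (fun k => `|u k|) M -> (forall i, has_sum (fun j => u (i, j)) (c i)) ->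
  exists2 s, has_sum u s & has_sum c s.
Proof.
move=> /has_sum_fiber[c' [s [_ [c'u cs us _ _]]]] cu; exists s => //.
suff -> : c = c' by []; apply/funext => i; exact: has_sum_unique (cu i) (c'u i).
Qed.

(** The family is spread over [J * I] with at most one nonzero entry for each [i]; Fubini then
    performs the grouping, and the absolute sum does not increase. *)
Lemma has_sum_group (I J : choiceType) (h : I -> J) (u : I -> R) M :
  psum (fun i => `|u i|) M ->
  exists c s N, [/\ forall j, has_sum (fun i => if h i == j then u i else 0) (c j),
    has_sum c s, has_sum u s, psum (fun j => `|c j|) N & N <= M].
Proof.
move=> uM.
pose v (k : J * I) := if h k.2 == k.1 then u k.2 else 0.
have vM' : psum (fun k : I * J => `|v (k.2, k.1)|) M.
  apply/(psum_pair M _ : psum (fun i => `|u i|) M <-> _) => // i.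
  have -> : `|u i| = (fun j => `|v (j, i)|) (h i) by rewrite /v/= eqxx.
  apply: psum1 => // j; rewrite /v/= eq_sym => /negbTE ->; by rewrite normr0.
have vM : psum (fun k => `|v k|) M.
  have := @psum_reindex _ _ _ (fun k : J * I => (k.2, k.1)) (fun k : I * J => (k.2, k.1)) _ M _ _ vM'.
  by case=> [[]|[]|h1 h2] //; split => [k|] //; rewrite -h2; apply: eq_esum => -[].
have [c [s [N [cv cs vs cN NM]]]] := has_sum_fiber vM.
exists c, s, N; split => //.
have vs' : has_sum (fun k : I * J => v (k.2, k.1)) s.
  apply: (@has_sum_reindex _ _ (fun k : I * J => (k.2, k.1)) (fun k : J * I => (k.2, k.1))) vs.
  - by case.
  - by case.
have [|s' h1 h2] := has_sum_fubini vM' (c := u).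
  move=> i; have E : u i = (fun j => v (j, i)) (h i) by rewrite /v/= eqxx.
  by rewrite [X in has_sum _ X]E; apply: has_sum1 => j; rewrite /v/= eq_sym => /negbTE ->.
by rewrite (has_sum_unique vs' h1).
Qed.

Lemma psumM (I J : choiceType) (p : I -> R) (q : J -> R) P Q :
  psum p P -> psum q Q -> psum (fun k : I * J => p k.1 * q k.2) (P * Q).
Proof.
move=> pP qQ; have p0 := pP.1; have Q0 := psum_ge0 qQ.
apply/(psum_pair _ (c := fun i => p i * Q)) => [i|]; first exact: psumZ (p0 i) qQ.
by rewrite mulrC; apply: psum_ext (psumZ Q0 pP) => i; rewrite mulrC.
Qed.

Lemma has_sumM (I J : choiceType) (u : I -> R) (v : J -> R) s t :
  has_sum u s -> has_sum v t ->
  has_sum (fun k : I * J => u k.1 * v k.2) (s * t).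
Proof.
move=> us vt; have [M uM] := has_sum_abs us; have [N vN] := has_sum_abs vt.
have uvMN : psum (fun k : I * J => `|u k.1 * v k.2|) (M * N).
  by apply: psum_ext (psumM uM vN) => k; rewrite normrM.
have [|s' h1 h2] := has_sum_fubini uvMN (c := fun i => u i * t).
  by move=> i; apply: has_sum_ext (has_sumZ (u i) vt) => j.
suff -> : s * t = s' by [].
apply: (has_sum_unique _ h2); rewrite mulrC.
by apply: has_sum_ext (has_sumZ t us) => i; rewrite mulrC.
Qed.

Lemma psum_series (p : nat -> R) (P : R) : (forall n, 0 <= p n) ->
  series p @ \oo --> P -> psum p P.
Proof.
move=> p0 pP; split => //.
rewrite -nneseries_esumT; last by move=> n; rewrite lee_fin.
apply/cvg_lim => //.
rewrite (_ : (fun _ => _) = EFin \o series p).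
  by apply: cvg_EFin => //; exact: nearW.
by apply/funext => n /=; rewrite sumEFin.
Qed.

Lemma cvg_psum (p : nat -> R) P : psum p P -> series p @ \oo --> P.
Proof.
move=> [p0]; rewrite -nneseries_esumT; last by move=> n; rewrite lee_fin.
move=> pP.
have cv : (fun n => \sum_(0 <= i < n) (p i)%:E)%E @ \oo --> P%:E.
  by rewrite -pP; apply: is_cvg_nneseries => n _ _; rewrite lee_fin.
rewrite (_ : series p = fine \o (fun n => \sum_(0 <= i < n) (p i)%:E)%E).
  exact: fine_cvg cv.
by apply/funext => n /=; rewrite sumEFin.
Qed.

Lemma has_sum_series (u : nat -> R) s : has_sum u s -> series u @ \oo --> s.
Proof.
move=> /has_sum_parts[p [q [P [Q [pP qQ upq ->]]]]].
rewrite (_ : series u = series p \- series q); last first.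
  by apply/funext => n; rewrite /series/= -sumrB; apply: eq_bigr => i _; rewrite upq.
by apply: cvgB; exact: cvg_psum.
Qed.

Lemma psum_shift (p : nat -> R) P :
  psum p P -> psum (fun n => p n.+1) (P - p 0%N).
Proof.
move=> pP; apply: psum_series; first by move=> n; case: pP.
rewrite (_ : series _ = (fun n => series p n.+1 - p 0%N)).
  by apply: cvgB; [rewrite cvg_shiftS; exact: cvg_psum|exact: cvg_cst].
by apply/funext => n; rewrite /series/= [in RHS]big_nat_recl//= addrC addKr.
Qed.

Lemma has_sum_shift (u : nat -> R) s :
  has_sum u s -> has_sum (fun n => u n.+1) (s - u 0%N).
Proof.
move=> /has_sum_parts[p [q [P [Q [pP qQ upq ->]]]]].
have -> : P - Q - u 0%N = (P - p 0%N) - (Q - q 0%N) by rewrite upq; ring.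
by apply: has_sum_psum (psum_shift pP) (psum_shift qQ) _ => i; rewrite upq.
Qed.

Lemma psum_expR (x : R) : 0 <= x -> psum (fun n => x ^+ n / n`!%:R) (expR x).
Proof.
move=> x0; apply: psum_series; first by move=> n; rewrite divr_ge0// exprn_ge0.
exact: is_cvg_series_exp_coeff.
Qed.

Lemma has_sum_expR (x : R) : has_sum (fun n => x ^+ n / n`!%:R) (expR x).
Proof.
have [|s xs _] := @has_sum_ex _ (fun n => x ^+ n / n`!%:R) (expR `|x|).
  apply: psum_ext (psum_expR (normr_ge0 x)) => n.
  by rewrite normrM normrX [`|_%:R^-1|]ger0_norm// invr_ge0.
suff -> : expR x = s by [].
by rewrite -(cvg_lim _ (has_sum_series xs)).
Qed.

End has_sum_theory.

(** * Power series with bounded Wiener norm *)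

Section power_series.
Context {R : realType} {d : nat}.
Implicit Types (alpha beta : {ffun 'I_d -> nat}) (y : 'rV[R]_d) (u v : 'rV[R]_d -> R).

Definition mdegree alpha : nat := (\sum_(i < d) alpha i)%N.

Definition monomial y alpha : R := \prod_(i < d) y 0 i ^+ alpha i.

Definition polydisc (r : R) y := forall i, `|y 0 i| <= r.

(* The Wiener algebra of the polydisc of radius r: u is there the sum of an
   absolutely convergent power series of norm at most M. The coefficients are
   hidden, so that only the closure properties below are ever used. *)
Definition wiener (r M : R) u : Prop := exists (c : {ffun 'I_d -> nat} -> R) (N : R),
  [/\ psum (fun alpha => `|c alpha| * r ^+ mdegree alpha) N, N <= M &
   forall y, polydisc r y -> has_sum (fun alpha => c alpha * monomial y alpha) (u y)].

Lemma monomial_le r y alpha : polydisc r y -> `|monomial y alpha| <= r ^+ mdegree alpha.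
Proof.
move=> yr; rewrite /monomial /mdegree normr_prod -prodrXr.
by apply: ler_prod => i _; rewrite normrX exprn_ge0//= lerXn2r// nnegrE ?(le_trans _ (yr i)).
Qed.

Lemma monomial_cst r alpha : monomial (\row_i r) alpha = r ^+ mdegree alpha.
Proof.
by rewrite /monomial /mdegree -prodrXr; apply: eq_bigr => i _; rewrite mxE.
Qed.

Lemma monomialD y alpha beta :
  monomial y [ffun i => (alpha i + beta i)%N] = monomial y alpha * monomial y beta.
Proof.
by rewrite /monomial -big_split; apply: eq_bigr => i _; rewrite ffunE exprD.
Qed.

Lemma mdegreeD alpha beta :
  mdegree [ffun i => (alpha i + beta i)%N] = (mdegree alpha + mdegree beta)%N.
Proof.
by rewrite /mdegree -big_split; apply: eq_bigr => i _; rewrite ffunE.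
Qed.

(* A series of monomials over an arbitrary index type: the coefficients are
   recovered by grouping the terms with the same multi-index. All closure
   properties under products and infinite sums are instances. *)
Lemma wiener_family (I : choiceType) (w : I -> R) (m : I -> {ffun 'I_d -> nat}) r M N u :
  0 < r -> psum (fun i => `|w i| * r ^+ mdegree (m i)) N -> N <= M ->
  (forall y, polydisc r y -> has_sum (fun i => w i * monomial y (m i)) (u y)) ->
  wiener r M u.
Proof.
move=> r0 wN NM wu.
have rX n : 0 < r ^+ n by rewrite exprn_gt0.
have rX0 n : r ^+ n != 0 by rewrite gt_eqF.
have wN' : psum (fun i => `|w i * r ^+ mdegree (m i)|) N.
  by apply: psum_ext wN => i; rewrite normrM (ger0_norm (ltW (rX _))).
have [c [s [N' [ch cs _ cN' N'N]]]] := has_sum_group m wN'.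
exists (fun al => c al / r ^+ mdegree al), N'; split; last 1 first.
- move=> y yr.
  have wy : psum (fun i => `|w i * monomial y (m i)|)
      (fine (\esum_(i in [set: I]) `|w i * monomial y (m i)|%:E)%E).
    have [|P pP _] := @psum_dom _ _ (fun i => `|w i * monomial y (m i)|) _ _ _ wN.
      by move=> i; rewrite normr_ge0 normrM ler_wpM2l// monomial_le.
    by have [_ ->] := pP.
  have [c' [s' [N'' [ch' cs' us' _ _]]]] := has_sum_group m wy.
  rewrite (has_sum_unique (wu y yr) us'); apply: has_sum_ext cs' => al.
  (* The monomial is constant on a fibre of [m], so the group sum at [y] is the group sum at radius
     [r], rescaled. *)
  have := has_sumZ (monomial y al / r ^+ mdegree al) (ch al).
  set f := fun i => _ => hf.
  have {}hf : has_sum (fun i => if m i == al then w i * monomial y (m i) else 0)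
      (monomial y al / r ^+ mdegree al * c al).
    apply: has_sum_ext hf => i; rewrite /f; case: eqP => [->|_]; last by rewrite mulr0.
    by field.
  by rewrite (has_sum_unique (ch' al) hf); ring.
- apply: psum_ext cN' => al.
  by rewrite normrM normfV (ger0_norm (ltW (rX _))) mulfVK.
- exact: le_trans NM.
Qed.

Lemma wiener_ge0 r M u : wiener r M u -> 0 <= M.
Proof. by move=> [c [N [/psum_ge0 N0 NM _]]]; exact: le_trans NM. Qed.

Lemma wiener_le r M M' u : M <= M' -> wiener r M u -> wiener r M' u.
Proof. by move=> MM [c [N [cN NM h]]]; exists c, N; split => //; exact: le_trans MM. Qed.

Lemma wiener_ext r M u v : (forall y, polydisc r y -> u y = v y) -> wiener r M u -> wiener r M v.
Proof. by move=> uv [c [N [cN NM h]]]; exists c, N; split => // y yr; rewrite -uv//; exact: h. Qed.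

Lemma wiener_bound r M u y : wiener r M u -> polydisc r y -> `|u y| <= M.
Proof.
move=> [c [N [cN NM h]]] yr; apply: le_trans NM.
have [|P pP PN] := @psum_dom _ _ (fun al => `|c al * monomial y al|) _ _ _ cN.
  by move=> al; rewrite normr_ge0 normrM ler_wpM2l// monomial_le.
exact: le_trans (has_sum_le_abs (h y yr) pP) PN.
Qed.

Lemma wiener_monomial r k alpha : 0 < r ->
  wiener r (`|k| * r ^+ mdegree alpha) (fun y => k * monomial y alpha).
Proof.
move=> r0; apply: (@wiener_family unit (fun=> k) (fun=> alpha)) => //.
  by apply: (@psum1 _ _ _ tt) => [|[]//]; rewrite mulr_ge0// exprn_ge0// ltW.
by move=> y _; apply: (@has_sum1 _ _ _ tt) => -[].
Qed.

Lemma wiener_cst r k : 0 < r -> wiener r `|k| (fun=> k).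
Proof.
move=> r0; have := wiener_monomial k [ffun=> 0%N] r0.
rewrite (_ : mdegree _ = 0%N); last by rewrite /mdegree big1// => i _; rewrite ffunE.
rewrite expr0 mulr1; apply: wiener_ext => y _.
by rewrite /monomial big1 ?mulr1// => i _; rewrite ffunE expr0.
Qed.

Lemma wiener_coord r i : 0 < r -> wiener r r (fun y => y 0 i).
Proof.
move=> r0; have := wiener_monomial 1 [ffun j => nat_of_bool (j == i)] r0.
rewrite (_ : mdegree _ = 1%N); last first.
  rewrite /mdegree (bigD1 i)//= big1 ?ffunE ?eqxx// => j ji.
  by rewrite ffunE (negbTE ji).
rewrite expr1 normr1 mul1r; apply: wiener_ext => y _.
rewrite /monomial (bigD1 i)//= big1 ?ffunE ?eqxx ?expr1 ?mulr1 ?mul1r// => j ji.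
by rewrite ffunE (negbTE ji).
Qed.

Lemma wiener_scale r M u k : 0 < r -> wiener r M u -> wiener r (`|k| * M) (fun y => k * u y).
Proof.
move=> r0 [c [N [cN NM h]]].
apply: (@wiener_family _ (fun al => k * c al) id _ _ (`|k| * N)) => //.
- by apply: psum_ext (psumZ (normr_ge0 k) cN) => al; rewrite normrM mulrA.
- by rewrite ler_wpM2l.
- by move=> y yr; apply: has_sum_ext (has_sumZ k (h y yr)) => al; rewrite mulrA.
Qed.

(** Completeness of the algebra in the form used below: norm-summable series are summed by
    regrouping the double series of their coefficients. *)
Lemma wiener_series (I : choiceType) (u : I -> 'rV[R]_d -> R) (M : I -> R) r S T U :
  0 < r -> (forall i, wiener r (M i) (u i)) -> psum M S -> S <= T ->
  (forall y, polydisc r y -> has_sum (fun i => u i y) (U y)) -> wiener r T U.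
Proof.
move=> r0 /choice[c /choice[N h]] MS ST uU.
have cN i : psum (fun al => `|c i al| * r ^+ mdegree al) (N i) by have [] := h i.
have [|S' NS' S'S] := @psum_dom _ _ N _ _ _ MS.
  by move=> i; rewrite (psum_ge0 (cN i)); have [] := h i.
have cS' : psum (fun k : I * {ffun 'I_d -> nat} =>
    `|c k.1 k.2| * r ^+ mdegree k.2) S' by apply/(psum_pair _ cN).
apply: (@wiener_family _ (fun k : I * {ffun 'I_d -> nat} => c k.1 k.2) snd _ _ S') => //.
  exact: le_trans ST.
move=> y yr.
have [|P pP _] := @psum_dom _ _ (fun k : I * {ffun 'I_d -> nat} =>
    `|c k.1 k.2 * monomial y k.2|) _ _ _ cS'.
  by move=> k; rewrite normr_ge0 normrM ler_wpM2l// monomial_le.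
have [|s h1 h2] := has_sum_fubini pP (c := fun i => u i y).
  by move=> i; have [_ _] := h i; exact.
by rewrite (has_sum_unique (uU y yr) h2).
Qed.

Lemma wiener_add r M N u v : 0 < r -> wiener r M u -> wiener r N v ->
  wiener r (M + N) (fun y => u y + v y).
Proof.
move=> r0 [c [M' [cM MM h]]] [c' [N' [cN NN h']]].
have [|P pP PMN] := @psum_dom _ _ (fun al => `|c al + c' al| * r ^+ mdegree al) _ _ _ (psumD cM cN).
  move=> al; rewrite mulr_ge0 ?exprn_ge0 ?(ltW r0)//= -mulrDl.
  by rewrite ler_wpM2r ?exprn_ge0 ?(ltW r0)// ler_normD.
exists (fun al => c al + c' al), P; split => //; first by apply: le_trans PMN _; exact: lerD.
by move=> y yr; apply: has_sum_ext (has_sumD (h y yr) (h' y yr)) => al; rewrite mulrDl.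
Qed.

Lemma wiener_sub r M N u v : 0 < r -> wiener r M u -> wiener r N v ->
  wiener r (M + N) (fun y => u y - v y).
Proof.
move=> r0 hu /(wiener_scale (-1) r0); rewrite normrN1 mul1r => /(wiener_add r0 hu).
by apply: wiener_ext => y _; rewrite mulN1r.
Qed.

Lemma wiener_mul r M N u v : 0 < r -> wiener r M u -> wiener r N v ->
  wiener r (M * N) (fun y => u y * v y).
Proof.
move=> r0 [c [M' [cM MM h]]] [c' [N' [cN NN h']]].
apply: (@wiener_family _ (fun k : {ffun 'I_d -> nat} * {ffun 'I_d -> nat} => c k.1 * c' k.2)
   (fun k => [ffun i => (k.1 i + k.2 i)%N]) _ _ (M' * N')) => //.
- apply: psum_ext (psumM cM cN) => k /=.
  by rewrite mdegreeD exprD normrM; ring.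
- by apply: ler_pM => //; [exact: psum_ge0 cM|exact: psum_ge0 cN].
- move=> y yr; apply: has_sum_ext (has_sumM (h y yr) (h' y yr)) => k /=.
  by rewrite monomialD; ring.
Qed.

Lemma wiener_exp r M u n : 0 < r -> wiener r M u -> wiener r (M ^+ n) (fun y => u y ^+ n).
Proof.
move=> r0 uM; elim: n => [|n ih].
  by rewrite expr0 -[X in wiener _ X]normr1; exact: wiener_cst.
by rewrite exprS; apply: wiener_ext (wiener_mul r0 uM ih) => y _; rewrite exprS.
Qed.

Lemma wiener_sum (I : Type) (s : seq I) (u : I -> 'rV[R]_d -> R) (M : I -> R) r :
  0 < r -> (forall i, wiener r (M i) (u i)) ->
  wiener r (\sum_(i <- s) M i) (fun y => \sum_(i <- s) u i y).
Proof.
move=> r0 h; elim: s => [|i s ih].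
  rewrite big_nil -[X in wiener _ X](normr0 R); apply: wiener_ext (wiener_cst 0 r0) => y _; rewrite big_nil//.
rewrite big_cons; apply: wiener_ext (wiener_add r0 (h i) ih) => y _; rewrite big_cons//.
Qed.

Lemma wiener_linear r (xi : 'I_d -> R) : 0 < r ->
  wiener r (r * \sum_i `|xi i|) (fun y => \sum_i xi i * y 0 i).
Proof.
move=> r0; rewrite mulr_sumr.
have := @wiener_sum _ (index_enum 'I_d) (fun i y => xi i * y 0 i) (fun i => r * `|xi i|) r r0.
apply=> i; rewrite mulrC; apply: wiener_scale => //; exact: wiener_coord.
Qed.

(** Telescoping by [u^(n+2) - v^(n+2) = u (u^(n+1) - v^(n+1)) + (u - v) v^(n+1)]; no division is
    involved. *)
Lemma wiener_expr_sub r M N u v n : 0 < r -> wiener r M u -> wiener r M v ->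
  wiener r N (fun y => u y - v y) ->
  wiener r (n.+1%:R * M ^+ n * N) (fun y => u y ^+ n.+1 - v y ^+ n.+1).
Proof.
move=> r0 uM vM uvN; elim: n => [|n ih].
  by rewrite expr0 mulr1 mul1r; apply: wiener_ext uvN => y _; rewrite !expr1.
have M0 := wiener_ge0 uM.
have -> : n.+2%:R * M ^+ n.+1 * N = M * (n.+1%:R * M ^+ n * N) + N * M ^+ n.+1.
  by rewrite [in LHS]mulrS exprS; ring.
apply: wiener_ext (wiener_add r0 (wiener_mul r0 uM ih) (wiener_mul r0 uvN (wiener_exp n.+1 r0 vM))) => y _.
by rewrite (exprS (u y) n.+1) (exprS (v y) n.+1); ring.
Qed.

Definition exp_remainder (x : R) : R := expR x - 1 - x.

Lemma has_sum_exp_remainder (x : R) :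
  has_sum (fun n => x ^+ n.+2 / n.+2`!%:R) (exp_remainder x).
Proof.
have := has_sum_shift (has_sum_shift (has_sum_expR x)).
by rewrite fact0 expr0 expr1 !divr1.
Qed.

(** The remainder starts at order two, so its Lipschitz constant [expR M - 1] on the ball of radius
    [M] vanishes with [M]. The contraction below rests on this. *)
Lemma wiener_exp_remainder r M N u v : 0 < r -> wiener r M u -> wiener r M v ->
  wiener r N (fun y => u y - v y) ->
  wiener r (N * (expR M - 1)) (fun y => exp_remainder (u y) - exp_remainder (v y)).
Proof.
move=> r0 uM vM uvN; have M0 := wiener_ge0 uM; have N0 := wiener_ge0 uvN.
apply: (@wiener_series _ (fun n y => n.+2`!%:R^-1 * (u y ^+ n.+2 - v y ^+ n.+2))
  (fun n => N * (M ^+ n.+1 / n.+1`!%:R)) _ (N * (expR M - 1))) => //.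
- move=> n; apply: wiener_le (wiener_scale n.+2`!%:R^-1 r0 (wiener_expr_sub n.+1 r0 uM vM uvN)).
  rewrite ger0_norm ?invr_ge0// factS natrM.
  have h1 : n.+2%:R != 0 :> R by rewrite pnatr_eq0.
  have h2 : n.+1`!%:R != 0 :> R by rewrite pnatr_eq0 -lt0n fact_gt0.
  rewrite le_eqVlt; apply/orP; left; apply/eqP; field.
  by rewrite h2 -(natrD _ 2 n) h1.
- have := psum_shift (psum_expR M0); rewrite fact0 expr0 divr1 => h.
  exact: psumZ N0 h.
- move=> y yr; apply: has_sum_ext (has_sumB (has_sum_exp_remainder (u y)) (has_sum_exp_remainder (v y))) => n.
  by rewrite -mulrBl mulrC.
Qed.

End power_series.

(** * Elementary estimates for sums and exponentials *)

Section psum_extra.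
Context {R : realType}.

Lemma psum_term_le (I : choiceType) (p : I -> R) P i : psum p P -> p i <= P.
Proof.
move=> pP; have p0 := pP.1.
have h : psum (fun j => if j == i then p i else 0) (if i == i then p i else 0).
  apply: (@psum1 _ _ (fun j => if j == i then p i else 0)) => [|j /negbTE ->//].
  by rewrite eqxx.
rewrite eqxx in h; apply: psum_le h pP => j.
by case: eqP => [->//|_]; exact: p0.
Qed.

Lemma psum_geometric_half : psum (fun n => 2^-1 ^+ n.+1) (1 : R).
Proof.
apply: psum_series; first by move=> n; rewrite exprn_ge0// invr_ge0.
have := @cvg_geometric_series R (2^-1) (2^-1).
rewrite ger0_norm ?invr_ge0//; rewrite invf_lt1 ?ltr1n// => /(_ isT).
have -> : (2^-1 / (1 - 2^-1) : R) = 1 by field.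
suff -> : series (geometric 2^-1 2^-1) = series (fun n => 2^-1 ^+ n.+1 : R) by [].
by apply/funext => n; apply: eq_bigr => k _; rewrite /geometric/= exprS.
Qed.

(** Trades a factor [x] for an arbitrarily small share [s] of the exponent, at the price [s^-1]. *)
Lemma le_expR_div (s x : R) : 0 < s -> x <= expR (s * x) / s.
Proof.
move=> s0; rewrite ler_pdivlMr// mulrC; apply: le_trans (expR_ge1Dx _).
by rewrite lerDr.
Qed.

Lemma expR_sub1_le (x : R) : expR x - 1 <= x * expR x.
Proof.
have h : (1 - x) * expR x <= 1.
  rewrite -[X in _ <= X](expR0 R) -(subrr x) (addrC x) expRD ler_wpM2r ?expR_ge0//.
  exact: expR_ge1Dx.
by lra.
Qed.

End psum_extra.

(** * The analytic implicit function *)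

Section implicit.
Context {R : realType} {d : nat} {I : choiceType}.
Variables (w lam : I -> R) (zeta : I -> 'I_d -> R).
Hypothesis w_ge0 : forall i, 0 <= w i.
Hypothesis lam_gt0 : forall i, 0 < lam i.

Definition dotp (xi : 'I_d -> R) (y : 'rV[R]_d) : R := \sum_k xi k * y 0 k.

(** When [t] and all coordinates of [y] move by at most [rho], the [i]-th exponent changes by at
    most [rho * exponent_size i]. *)
Definition exponent_size i : R := lam i + \sum_k `|zeta i k|.

Variables (rho K : R).
Hypothesis rho_gt0 : 0 < rho.
Hypothesis w1 : psum w 1.
Hypothesis wK : psum (fun i => w i * expR (rho * exponent_size i)) K.

(** Three shares [sigma] of the exponent are spent in [dom]: two on the square of [exponent_size],
    one on the exponential already present. *)
Let sigma : R := rho / 4.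
Let sigma_gt0 : 0 < sigma. Proof. exact: divr_gt0. Qed.

Let zeta_ge0 i : 0 <= \sum_k `|zeta i k|. Proof. exact: sumr_ge0. Qed.

Let size_gt0 i : 0 < exponent_size i.
Proof. by rewrite /exponent_size ltr_wpDr. Qed.

Let wK0 i : 0 <= w i * expR (rho * exponent_size i).
Proof. by rewrite mulr_ge0// expR_ge0. Qed.

Let dom i : w i * (exponent_size i ^+ 2 * expR (sigma * exponent_size i)) <=
   sigma ^- 2 * (w i * expR (rho * exponent_size i)).
Proof.
have h := le_expR_div (exponent_size i) sigma_gt0.
have h2 : exponent_size i ^+ 2 <= (expR (sigma * exponent_size i) / sigma) ^+ 2.
  by rewrite lerXn2r// nnegrE ?(ltW (size_gt0 _))// divr_ge0 ?expR_ge0 ?(ltW sigma_gt0).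
rewrite [leRHS]mulrCA ler_wpM2l//.
apply: (@le_trans _ _ ((expR (sigma * exponent_size i) / sigma) ^+ 2 * expR (sigma * exponent_size i))).
  by rewrite ler_wpM2r// expR_ge0.
rewrite exprMn exprVn mulrAC mulrC ler_wpM2l ?invr_ge0 ?exprn_ge0 ?(ltW sigma_gt0)//.
rewrite -expRM_natl -expRD ler_expR.
have := mulr_gt0 rho_gt0 (size_gt0 i); rewrite /sigma => ?; lra.
Qed.

Let dom1 i : w i * (exponent_size i * expR (sigma * exponent_size i)) <=
   sigma^-1 * (w i * expR (rho * exponent_size i)).
Proof.
have h := le_expR_div (exponent_size i) sigma_gt0.
rewrite [leRHS]mulrCA ler_wpM2l//.
apply: (@le_trans _ _ ((expR (sigma * exponent_size i) / sigma) * expR (sigma * exponent_size i))).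
  by rewrite ler_wpM2r// expR_ge0.
rewrite mulrAC mulrC ler_wpM2l ?invr_ge0 ?(ltW sigma_gt0)//.
rewrite -expRD ler_expR.
have := mulr_gt0 rho_gt0 (size_gt0 i); rewrite /sigma => ?; lra.
Qed.

(** [- L] is the derivative in [t] of the left-hand side at the base point. It is nonzero: [L = 0]
    would force all weights to vanish, against [w1]. *)
Let lam_psum : exists2 L, psum (fun i => w i * lam i) L & 0 < L.
Proof.
have sV : 0 <= sigma^-1 by rewrite invr_ge0 ltW.
have [|L wL _] := @psum_dom _ _ (fun i => w i * lam i) _ _ _ (psumZ sV wK).
  move=> i; rewrite mulr_ge0 ?(ltW (lam_gt0 _))//=.
  apply: le_trans (dom1 i); rewrite ler_wpM2l//.
  rewrite -[leLHS]mulr1 ler_pM ?(ltW (lam_gt0 _))//.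
    by rewrite /exponent_size lerDl.
  by rewrite -expR0 ler_expR mulr_ge0 ?(ltW sigma_gt0) ?(ltW (size_gt0 _)).
exists L => //; rewrite lt_neqAle (psum_ge0 wL) andbT.
apply/negP => /eqP L0; have /eqP := @oner_neq0 R; apply.
apply: psum_unique w1 _; apply: psum_ext (psum0 I) => i.
have := psum_term_le i wL; rewrite -L0 => h.
apply/esym/eqP; rewrite eq_le w_ge0 andbT.
by rewrite -(pmulr_lle0 _ (lam_gt0 i)).
Qed.

Let L := projT1 (cid2 lam_psum).
Let wL : psum (fun i => w i * lam i) L. Proof. exact: (s2valP (cid2 lam_psum)). Qed.
Let L_gt0 : 0 < L. Proof. exact: (s2valP' (cid2 lam_psum)). Qed.

Let K_ge0 : 0 <= K. Proof. exact: psum_ge0 wK. Qed.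

(** Makes the contraction factor [theta * K / (sigma * L)] at most one half; [K + 1] keeps the
    denominator positive, and the cap 1 keeps [rho1] below [sigma]. *)
Let theta : R := Num.min 1 (sigma * L / (2 * (K + 1))).
Let theta_gt0 : 0 < theta.
Proof.
rewrite lt_min ltr01/= divr_gt0// ?mulr_gt0//; have := K_ge0; lra.
Qed.
Let theta_le1 : theta <= 1. Proof. by rewrite ge_min lexx. Qed.
Let theta_le : theta * K / (sigma * L) <= 2^-1.
Proof.
rewrite ler_pdivrMr ?mulr_gt0//.
have h : theta <= sigma * L / (2 * (K + 1)) by rewrite ge_min lexx orbT.
have K1 : 0 < 2 * (K + 1) by have := K_ge0; lra.
move: h; rewrite ler_pdivlMr// => h; have := theta_gt0; nra.
Qed.

Let rho1 : R := theta * sigma.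
Let rho1_gt0 : 0 < rho1. Proof. exact: mulr_gt0. Qed.

(** The unknown lives in the ball of radius [rho1]. The polydisc is smaller, so that the first
    iterate has norm at most [rho1 / 2]; with contraction factor one half, no iterate leaves the
    ball. *)
Let r : R := Num.min rho1 (rho1 * sigma * L / (2 * (K + 1))).
Let r_gt0 : 0 < r.
Proof.
rewrite lt_min rho1_gt0/= divr_gt0// ?mulr_gt0//; have := K_ge0; lra.
Qed.
Let r_le : r <= rho1. Proof. by rewrite ge_min lexx. Qed.
Let r_le2 : r * K / (sigma * L) <= rho1 / 2.
Proof.
rewrite ler_pdivrMr ?mulr_gt0//.
have h : r <= rho1 * sigma * L / (2 * (K + 1)) by rewrite ge_min lexx orbT.
have K1 : 0 < 2 * (K + 1) by have := K_ge0; lra.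
move: h; rewrite ler_pdivlMr// => h; have := r_gt0; nra.
Qed.

Let M i : R := rho1 * exponent_size i.
Let M_ge0 i : 0 <= M i. Proof. by rewrite mulr_ge0 ?(ltW rho1_gt0) ?(ltW (size_gt0 _)). Qed.
Let M_le i : M i <= sigma * exponent_size i.
Proof. by rewrite ler_wpM2r ?(ltW (size_gt0 _))// ger_pMl. Qed.

Let arg (u : 'rV[R]_d -> R) i y := dotp (zeta i) y - lam i * u y.

Let wiener_arg u i : wiener r rho1 u -> wiener r (M i) (arg u i).
Proof.
move=> uN; have := wiener_sub r_gt0 (wiener_linear (zeta i) r_gt0) (wiener_scale (lam i) r_gt0 uN).
apply: wiener_le; rewrite gtr0_norm// /M /exponent_size mulrDr addrC [lam i * _]mulrC lerD2l.
by rewrite ler_wpM2r.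
Qed.

(** [fine] returns 0 on a divergent sum; only values on the polydisc with [|t| <= rho1] matter, and
    [psum_T] gives convergence there. *)
Let T (y : 'rV[R]_d) (t : R) : R :=
  fine (\esum_(i in [set: I]) (w i * expR (dotp (zeta i) y - lam i * t))%:E)%E.

Let wiener_t (t : R) : `|t| <= rho1 -> wiener r rho1 (fun _ : 'rV[R]_d => t).
Proof. by move=> t1; apply: wiener_le t1 _; exact: wiener_cst. Qed.

Let psum_T y t : polydisc r y -> `|t| <= rho1 ->
  psum (fun i => w i * expR (dotp (zeta i) y - lam i * t)) (T y t).
Proof.
move=> yr tr.
have [|S S1 _] := @psum_dom _ _ (fun i => w i * expR (dotp (zeta i) y - lam i * t)) _ _ _ wK.
  move=> i; rewrite mulr_ge0 ?expR_ge0//= ler_wpM2l// ler_expR.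
  have := wiener_bound (wiener_arg i (wiener_t tr)) yr; rewrite /arg => h.
  apply: le_trans (le_trans (ler_norm _) h) _.
  apply: le_trans (M_le i) _; rewrite ler_wpM2r ?(ltW (size_gt0 _))//.
  by rewrite /sigma; have := rho_gt0; lra.
by have := S1; rewrite /T => -[_ ->].
Qed.

(* Newton's iteration with the frozen derivative - L, for the equation
   sum_i w i exp (zeta i . y - lam i u) = 1. *)
Let Phi (u : 'rV[R]_d -> R) y : R := u y + (T y (u y) - 1) / L.

(* The linear terms in u cancel: this is why Phi contracts. *)
Let has_sum_Phi u y : polydisc r y -> `|u y| <= rho1 ->
  has_sum (fun i => w i / L * (exp_remainder (arg u i y) + dotp (zeta i) y)) (Phi u y).
Proof.
move=> yr ur.
have h1 := has_sum_of_psum (psum_T yr ur).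
have h2 := has_sumZ L^-1 (has_sumD (has_sumB h1 (has_sum_of_psum w1)) (has_sumZ (u y) (has_sum_of_psum wL))).
have -> : Phi u y = L^-1 * (T y (u y) - 1 + u y * L).
  by rewrite /Phi; field; exact: lt0r_neq0.
apply: has_sum_ext h2 => i; rewrite /exp_remainder /arg; field; exact: lt0r_neq0.
Qed.

(** The Lipschitz constant of the [i]-th term is [lam i * (expR (M i) - 1)]. It contains [rho1],
    which supplies the small factor [theta], and two powers of [exponent_size i], which [dom]
    absorbs. *)
Let contract u v N : wiener r rho1 u -> wiener r rho1 v -> wiener r N (fun y => u y - v y) ->
  wiener r (N / 2) (fun y => Phi u y - Phi v y).
Proof.
move=> uN vN uvN; have N0 := wiener_ge0 uvN.
apply: (@wiener_series _ _ _ (fun i y => w i / L * (exp_remainder (arg u i y) - exp_remainder (arg v i y)))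
  (fun i => N * theta / (sigma * L) * (w i * expR (rho * exponent_size i))) _
  (N * theta / (sigma * L) * K)) => //.
- move=> i.
  have auv : wiener r (lam i * N) (fun y => arg u i y - arg v i y).
    have := wiener_scale (- lam i) r_gt0 uvN; rewrite normrN gtr0_norm//.
    by apply: wiener_ext => y _; rewrite /arg; ring.
  apply: wiener_le (wiener_scale (w i / L) r_gt0 (wiener_exp_remainder r_gt0 (wiener_arg i uN) (wiener_arg i vN) auv)).
  rewrite ger0_norm ?divr_ge0// ?(ltW L_gt0)//.
  have e1 : expR (M i) - 1 <= rho1 * (exponent_size i * expR (sigma * exponent_size i)).
    apply: le_trans (expR_sub1_le _) _.
    by rewrite mulrA -/(M i) ler_wpM2l ?ler_expR.
  have lam_le : lam i <= exponent_size i by rewrite /exponent_size lerDl.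
  have e2 : lam i * (expR (M i) - 1) <= rho1 * (exponent_size i ^+ 2 * expR (sigma * exponent_size i)).
    rewrite expr2 -mulrA mulrCA.
    apply: ler_pM => //; first exact: ltW.
    by rewrite subr_ge0 -expR0 ler_expR; exact: M_ge0.
  have e3 : w i * (lam i * (expR (M i) - 1)) <= rho1 * (sigma ^- 2 * (w i * expR (rho * exponent_size i))).
    apply: le_trans (ler_wpM2l (w_ge0 i) e2) _.
    by rewrite mulrCA ler_wpM2l ?(ltW rho1_gt0)//; exact: dom.
  have -> : w i / L * (lam i * N * (expR (M i) - 1)) =
      N / L * (w i * (lam i * (expR (M i) - 1))) by ring.
  have -> : N * theta / (sigma * L) * (w i * expR (rho * exponent_size i)) =
      N / L * (rho1 * (sigma ^- 2 * (w i * expR (rho * exponent_size i)))).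
    by rewrite /rho1; field; rewrite !lt0r_neq0.
  by rewrite ler_wpM2l// divr_ge0// ltW.
- apply: psumZ wK.
  by apply: divr_ge0; apply: mulr_ge0 => //; exact: ltW.
- have := ler_wpM2l N0 theta_le.
  suff -> : N * (theta * K / (sigma * L)) = N * theta / (sigma * L) * K by [].
  by ring.
- move=> y yr; have := has_sumB (has_sum_Phi yr (wiener_bound uN yr)) (has_sum_Phi yr (wiener_bound vN yr)).
  by apply: has_sum_ext => i; ring.
Qed.

(** At [u = 0] the exponents are linear in [y], hence [O(r)]. The zero term [exp_remainder 0] is
    inserted so that the Lipschitz bound applies. *)
Let first_step : wiener r (rho1 / 2) (Phi (fun=> 0)).
Proof.
apply: (@wiener_series _ _ _ (fun i y => w i / L * ((exp_remainder (dotp (zeta i) y) - exp_remainder 0)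
     + dotp (zeta i) y))
  (fun i => r / (sigma * L) * (w i * expR (rho * exponent_size i))) _
  (r / (sigma * L) * K)) => //.
- move=> i.
  have h1 := wiener_linear (zeta i) r_gt0.
  set N := r * _ in h1; have N0 := wiener_ge0 h1.
  have h0 : wiener r N (fun _ : 'rV[R]_d => 0).
    by apply: wiener_le (wiener_cst 0 r_gt0); rewrite normr0.
  have h10 : wiener r N (fun y => dotp (zeta i) y - 0).
    by apply: wiener_ext h1 => y _; rewrite subr0.
  have := wiener_scale (w i / L) r_gt0 (wiener_add r_gt0 (wiener_exp_remainder r_gt0 h1 h0 h10) h1).
  apply: wiener_le.
  have Ns : N <= r * exponent_size i by rewrite /N ler_wpM2l ?(ltW r_gt0)// /exponent_size lerDr ltW.
  have -> : N * (expR N - 1) + N = N * expR N by ring.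
  rewrite ger0_norm ?divr_ge0// ?(ltW L_gt0)//.
  have e1 : N * expR N <= r * (exponent_size i * expR (sigma * exponent_size i)).
    rewrite mulrA; apply: ler_pM => //.
    rewrite ler_expR; apply: le_trans Ns _; apply: le_trans (M_le i).
    by rewrite ler_wpM2r// ltW.
  have e2 : w i * (N * expR N) <= r * (sigma^-1 * (w i * expR (rho * exponent_size i))).
    apply: le_trans (ler_wpM2l (w_ge0 i) e1) _.
    by rewrite mulrCA ler_wpM2l ?(ltW r_gt0)//; exact: dom1.
  have -> : w i / L * (N * expR N) = L^-1 * (w i * (N * expR N)) by ring.
  have -> : r / (sigma * L) * (w i * expR (rho * exponent_size i)) =
      L^-1 * (r * (sigma^-1 * (w i * expR (rho * exponent_size i)))).
    by field; rewrite !lt0r_neq0.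
  by rewrite ler_wpM2l// invr_ge0 ltW.
- apply: psumZ wK.
  by rewrite divr_ge0 ?ltW// mulr_gt0.
- by rewrite mulrAC.
- move=> y yr; have := @has_sum_Phi (fun=> 0) y yr _; rewrite normr0 => /(_ (ltW rho1_gt0)).
  by apply: has_sum_ext => i; rewrite /arg mulr0 subr0 /exp_remainder expR0; ring.
Qed.

Let U n := iter n Phi (fun=> 0).

Let wiener_U n : wiener r (rho1 * (1 - 2^-1 ^+ n)) (U n) /\
  wiener r (rho1 * 2^-1 ^+ n.+1) (fun y => U n.+1 y - U n y).
Proof.
elim: n => [|n [ih1 ih2]].
  rewrite expr0 subrr mulr0 expr1; split.
    by rewrite -[X in wiener _ X](normr0 R); exact: wiener_cst.
  by apply: wiener_ext first_step => y _; rewrite subr0.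
have le1 k : rho1 * (1 - 2^-1 ^+ k) <= rho1.
  by rewrite ger_pMr// gerBl exprn_ge0// invr_ge0.
have h : wiener r (rho1 * (1 - 2^-1 ^+ n.+1)) (U n.+1).
  have -> : rho1 * (1 - 2^-1 ^+ n.+1) = rho1 * (1 - 2^-1 ^+ n) + rho1 * 2^-1 ^+ n.+1.
    by rewrite exprS; field.
  by apply: wiener_ext (wiener_add r_gt0 ih1 ih2) => y _; ring.
split => //.
have := contract (wiener_le (le1 _) h) (wiener_le (le1 _) ih1) ih2.
by apply: wiener_le; rewrite -mulrA -exprSr.
Qed.

Lemma implicit_local : exists (r' M' : R) (V : 'rV[R]_d -> R),
  [/\ 0 < r', wiener r' M' V &
   forall y, polydisc r' y ->
    psum (fun i => w i * expR (dotp (zeta i) y - lam i * V y)) 1].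
Proof.
have /choice[V hV] : forall y, exists s, polydisc r y ->
    has_sum (fun n => U n.+1 y - U n y) s.
  move=> y; have [yr|] := pselect (polydisc r y); last by exists 0.
  have [|P pP _] := @psum_dom _ _ (fun n => `|U n.+1 y - U n y|) _ _ _
      (psumZ (ltW rho1_gt0) psum_geometric_half).
    move=> n; rewrite normr_ge0/=; exact: wiener_bound (wiener_U n).2 yr.
  by have [s hs _] := has_sum_ex pP; exists s.
have VN : wiener r rho1 V.
  apply: (@wiener_series _ _ _ (fun n y => U n.+1 y - U n y) _ _ _ _ _ r_gt0
     (fun n => (wiener_U n).2) (psumZ (ltW rho1_gt0) psum_geometric_half)) => //.
  by rewrite mulr1.
exists r, rho1, V; split => // y yr.
have Vy := wiener_bound VN yr.
suff <- : T y (V y) = 1 by exact: psum_T.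
have UV : U n y @[n --> \oo] --> V y.
  have := has_sum_series (hV y yr).
  suff -> : series (fun n => U n.+1 y - U n y) = (fun n => U n y) by [].
  by apply/funext => n; rewrite /series/= telescope_sumr//= subr0.
have UV' : U n.+1 y @[n --> \oo] --> V y by rewrite (cvg_shiftS (fun n => U n y)).
have UP : U n.+1 y @[n --> \oo] --> Phi V y.
  apply/cvgrPdist_le => e e0; near=> n.
  have Un : `|U n y| <= rho1.
    apply: le_trans (wiener_bound (wiener_U n).1 yr) _.
    by rewrite ger_pMr// gerBl exprn_ge0// invr_ge0.
  (* Continuity of [Phi] in the value at [y]: [contract] is applied to the two constant functions
     [V y] and [U n y], and evaluated at [y]. *)
  have h : wiener r `|V y - U n y| (fun y' : 'rV[R]_d => V y - U n y) by exact: wiener_cst.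
  have := wiener_bound (contract (wiener_t Vy) (wiener_t Un) h) yr.
  rewrite /= {2 4}/Phi => /le_trans; apply.
  rewrite ler_pdivrMr//; apply: (@le_trans _ _ e); last by lra.
  near: n; exact: cvgr_dist_le.
have := cvg_unique (@Rhausdorff R) UV' UP; rewrite /Phi => /(_ _) h.
have /eqP : (T y (V y) - 1) / L = 0.
  by move: h; set q := _ / L => h; apply/eqP; lra.
by rewrite mulf_eq0 invr_eq0 (gt_eqF L_gt0) orbF subr_eq0 => /eqP.
Unshelve. all: by end_near. Qed.

End implicit.

(** * Local expansions and analyticity of the implicit function *)

Section analytic.
Context {R : realType} {d : nat}.
Implicit Types (g : 'rV[R]_d -> R).

Lemma nbhs_polydisc (a : 'rV[R]_d) (A : set 'rV[R]_d) :
  nbhs a A -> exists2 r, 0 < r & forall y, polydisc r y -> A (a + y).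
Proof.
move=> /nbhs_ballP[e e0 eA]; exists (e / 2); first exact: divr_gt0.
move=> y yr; apply: eA; split => // i j; rewrite ord1 !mxE.
rewrite /ball/= opprD addNKr normrN.
by apply: le_lt_trans (yr j) _; rewrite ltr_pdivrMr//; have := e0; rewrite /=; lra.
Qed.

Lemma polydisc_nbhs (a : 'rV[R]_d) (A : set 'rV[R]_d) r : 0 < r ->
  (forall y, polydisc r y -> A (a + y)) -> nbhs a A.
Proof.
move=> r0 h; apply/nbhs_ballP; exists r => // x xr.
have -> : x = a + (x - a) by rewrite addrC subrK.
apply: h => j; rewrite !mxE; have := xr.2 0 j; rewrite /ball/= => /ltW.
by rewrite distrC.
Qed.

Lemma real_analyticP g : real_analytic g <->
  (forall a, exists r M, 0 < r /\ wiener r M (fun y => g (a + y))).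
Proof.
split=> h a; last first.
  have [r [M [r0 [c [N [_ _ hc]]]]]] := h a.
  exists c; apply: polydisc_nbhs r0 _ => y yr /=.
  apply: has_sum_ext (hc y yr) => al; congr (_ * _).
  by apply: eq_bigr => i _; rewrite mxE addrAC subrr add0r.
have [c /nbhs_polydisc[r r0 hc]] := h a.
have hy y : polydisc r y ->
    has_sum (fun al => c al * monomial y al) (g (a + y)).
  move=> yr; apply: has_sum_ext (hc y yr) => al; congr (_ * _).
  by apply: eq_bigr => i _; rewrite mxE addrAC subrr add0r.
(* Absolute convergence at the corner [(r, ..., r)] of the polydisc is finiteness of the Wiener
   norm. *)
have [|M cM] := has_sum_abs (hy (\row_i r) _).
  by move=> i; rewrite mxE ger0_norm// ltW.
exists r, M; split => //; exists c, M; split => //.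
apply: psum_ext cM => al; rewrite normrM monomial_cst.
by rewrite [X in _ * X]ger0_norm// exprn_ge0// ltW.
Qed.

Lemma dotpD (xi : 'I_d -> R) (x y : 'rV[R]_d) : dotp xi (x + y) = dotp xi x + dotp xi y.
Proof. by rewrite /dotp -big_split; apply: eq_bigr => k _; rewrite mxE mulrDr. Qed.

(** Each exponential strictly decreases in [t], so two roots would force every [p i] to vanish. *)
Lemma psum_expR_unique (I : choiceType) (p lam : I -> R) (t t' : R) :
  (forall i, 0 <= p i) -> (forall i, 0 < lam i) ->
  psum (fun i => p i * expR (- (lam i * t))) 1 ->
  psum (fun i => p i * expR (- (lam i * t'))) 1 -> t = t'.
Proof.
move=> p0 lam0; wlog tt : t t' / t < t'.
  by move=> W h h'; case: (ltgtP t t') => // tt; [exact: W|apply/esym; exact: W].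
move=> h h'; exfalso.
have lt i : expR (- (lam i * t')) < expR (- (lam i * t)).
  by rewrite ltr_expR ltrN2 ltr_pM2l.
have h2 := has_sumB (has_sum_of_psum h) (has_sum_of_psum h'); rewrite subrr in h2.
have {}h2 := psum_of_has_sum _ h2.
have {}h2 : psum (fun i => p i * expR (- (lam i * t)) - p i * expR (- (lam i * t'))) 0.
  by apply: h2 => i; rewrite subr_ge0 ler_wpM2l// ltW.
have pi0 i : p i = 0.
  have := psum_term_le i h2; rewrite -mulrBr pmulr_lle0 ?subr_gt0// => pi.
  by apply/eqP; rewrite eq_le pi p0.
have : (1 : R) = 0.
  by apply: psum_unique h _; apply: psum_ext (psum0 I) => i; rewrite pi0 mul0r.
by move/eqP; rewrite oner_eq0.
Qed.

(** The values of the terms at [a] become the weights of the recentred equation. Uniqueness of the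
    root identifies [g] with the local solution, so no continuity of [g] is assumed. *)
Lemma implicit_analytic (I : choiceType) (w lam : I -> R) (zeta : I -> 'I_d -> R) g :
  (forall i, 0 <= w i) -> (forall i, 0 < lam i) ->
  (forall x, psum (fun i => w i * expR (dotp (zeta i) x - lam i * g x)) 1) ->
  (forall a, exists rho K, 0 < rho /\
     psum (fun i => w i * expR (dotp (zeta i) a - lam i * g a + rho * exponent_size lam zeta i)) K) ->
  real_analytic g.
Proof.
move=> w0 lam0 wg hK; apply/real_analyticP => a.
have [rho [K [rho0 wK]]] := hK a.
pose w' i := w i * expR (dotp (zeta i) a - lam i * g a).
have w'0 i : 0 <= w' i by rewrite mulr_ge0// expR_ge0.
have w'K : psum (fun i => w' i * expR (rho * exponent_size lam zeta i)) K.
  by apply: psum_ext wK => i; rewrite expRD mulrA.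
have [r [M [V [r0 VM hV]]]] := implicit_local w'0 lam0 rho0 (wg a) w'K.
exists r, (M + `|g a|); split => //.
apply: wiener_ext (wiener_add r0 VM (wiener_cst (g a) r0)) => y yr.
apply: (@psum_expR_unique _ (fun i => w i * expR (dotp (zeta i) (a + y))) lam) => //.
- by move=> i; rewrite mulr_ge0// expR_ge0.
- apply: psum_ext (hV y yr) => i; rewrite /w' -!mulrA -!expRD dotpD.
  by congr (_ * expR _); ring.
- by apply: psum_ext (wg (a + y)) => i; rewrite -mulrA -expRD.
Qed.

End analytic.

(** * Derivatives of analytic functions *)

Section analytic_derive.
Context {R : realType}.

(** The remainder is multiplied by [s ^+ 2] instead of dividing the bound by it: no negative power
    occurs for [n < 2], and [s = 0] is allowed. *)
Lemma expr_taylor2 (s x h : R) n : `|x| <= s -> `|x + h| <= s ->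
  `|(x + h) ^+ n - x ^+ n - h * (n%:R * x ^+ n.-1)| * s ^+ 2 <=
    h ^+ 2 * (n%:R ^+ 2 * s ^+ n).
Proof.
move=> xs xhs; have s0 : 0 <= s by exact: le_trans xs.
elim: n => [|n ih].
  by rewrite !expr0 subrr !mul0r mulr0 subrr normr0 expr0n/= !mul0r mulr0.
pose A := (x + h) ^+ n - x ^+ n - h * (n%:R * x ^+ n.-1).
have -> : (x + h) ^+ n.+1 - x ^+ n.+1 - h * (n.+1%:R * x ^+ n.+1.-1) =
    (x + h) * A + h ^+ 2 * (n%:R * x ^+ n.-1).
  case: n @A {ih} => [|n] A /=; rewrite /A/= !exprS ?expr0; first by ring.
  by rewrite -[n.+2%:R]natr1; ring.
have e1 : `|h ^+ 2 * (n%:R * x ^+ n.-1)| * s ^+ 2 <= h ^+ 2 * (n%:R * s ^+ n.+1).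
  case: n {ih A} => [|n] /=; first by rewrite !mul0r mulr0 normr0 mul0r.
  rewrite normrM ger0_norm ?sqr_ge0// -mulrA ler_wpM2l ?sqr_ge0//.
  rewrite normrM ger0_norm// -mulrA ler_wpM2l// normrX.
  by rewrite -[n.+2]addn2 exprD ler_wpM2r ?sqr_ge0// lerXn2r// nnegrE.
have e2 : `|(x + h) * A| * s ^+ 2 <= s * (h ^+ 2 * (n%:R ^+ 2 * s ^+ n)).
  by rewrite normrM -mulrA ler_pM// mulr_ge0// sqr_ge0.
apply: (@le_trans _ _ ((`|(x + h) * A| + `|h ^+ 2 * (n%:R * x ^+ n.-1)|) * s ^+ 2)).
  by rewrite ler_wpM2r ?sqr_ge0// ler_normD.
rewrite mulrDl; apply: le_trans (lerD e2 e1) _.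
have -> : s * (h ^+ 2 * (n%:R ^+ 2 * s ^+ n)) + h ^+ 2 * (n%:R * s ^+ n.+1) =
  h ^+ 2 * ((n%:R ^+ 2 + n%:R) * s ^+ n.+1) by rewrite (exprS s n); ring.
rewrite ler_wpM2l ?sqr_ge0// ler_wpM2r ?exprn_ge0// -natr1.
by have : (0 : R) <= n%:R by []; nra.
Qed.

(** Passing to a quarter of the radius pays for the factor [n ^ 2] left by two differentiations,
    since [n <= 2 ^ n]. *)
Lemma natr_expr4 (r : R) n : 0 <= r -> n%:R ^+ 2 * (r / 4) ^+ n <= r ^+ n.
Proof.
move=> r0; rewrite exprMn exprVn mulrCA ler_piMr ?exprn_ge0// ler_pdivrMr ?exprn_gt0// mul1r.
have -> : (4 : R) = 2 ^+ 2 by rewrite expr2; ring.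
by rewrite -exprM mulnC exprM lerXn2r ?nnegrE ?exprn_ge0// -natrX ler_nat ltnW// ltn_expl.
Qed.

Context {d : nat}.
Implicit Types (alpha : {ffun 'I_d -> nat}) (y : 'rV[R]_d) (u v : 'rV[R]_d -> R).

(** The truncated predecessor leaves [alpha] unchanged when [alpha i = 0]; the factor [alpha i] of
    the derivative is then zero. *)
Definition lower_index i alpha : {ffun 'I_d -> nat} :=
  [ffun j => if j == i then (alpha j).-1 else alpha j].

Definition monomial_except i y alpha : R := \prod_(j < d | j != i) y 0 j ^+ alpha j.

Lemma monomial_exceptE i y alpha : monomial y alpha = y 0 i ^+ alpha i * monomial_except i y alpha.
Proof. by rewrite /monomial (bigD1 i). Qed.

Lemma monomial_except_shift i y h alpha : monomial_except i (h *: delta_mx 0 i + y) alpha = monomial_except i y alpha.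
Proof.
apply: eq_bigr => j ji; rewrite !mxE eqxx/= (negbTE ji) mulr0 add0r//.
Qed.

Lemma monomial_except_lower_index i y alpha : monomial_except i y (lower_index i alpha) = monomial_except i y alpha.
Proof. by apply: eq_bigr => j ji; rewrite ffunE (negbTE ji). Qed.

Lemma mdegree_lower_index i alpha : (0 < alpha i)%N ->
  mdegree alpha = (mdegree (lower_index i alpha)).+1.
Proof.
move=> ai; rewrite /mdegree (bigD1 i)//= [in RHS](bigD1 i)//= ffunE eqxx.
rewrite -addSn prednK//; congr addn; apply: eq_bigr => j ji.
by rewrite ffunE (negbTE ji).
Qed.

Lemma mdegree_ge i alpha : (alpha i <= mdegree alpha)%N.
Proof. by rewrite /mdegree (bigD1 i)//= leq_addr. Qed.

Lemma monomial_taylor2 i (s h : R) y alpha : 0 <= s ->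
  polydisc s y -> polydisc s (h *: delta_mx 0 i + y) ->
  `|monomial (h *: delta_mx 0 i + y) alpha - monomial y alpha
      - h * ((alpha i)%:R * monomial y (lower_index i alpha))| * s ^+ 2
    <= h ^+ 2 * ((alpha i)%:R ^+ 2 * s ^+ mdegree alpha).
Proof.
move=> s0 ys yhs.
rewrite !(monomial_exceptE i) monomial_except_shift monomial_except_lower_index ffunE eqxx.
have -> : (h *: delta_mx 0 i + y) 0 i = y 0 i + h.
  by rewrite !mxE !eqxx mulr1 addrC.
set x := y 0 i; set n := alpha i; set q := monomial_except i y alpha.
have -> : (x + h) ^+ n * q - x ^+ n * q - h * (n%:R * (x ^+ n.-1 * q)) =
   ((x + h) ^+ n - x ^+ n - h * (n%:R * x ^+ n.-1)) * q by ring.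
have qs : `|q| <= s ^+ (\sum_(j < d | j != i) alpha j)%N.
  rewrite /q /monomial_except normr_prod -prodrXr.
  apply: ler_prod => j _; rewrite normrX exprn_ge0//= lerXn2r// nnegrE.
have xh : `|x + h| <= s.
  by have := yhs i; rewrite !mxE !eqxx mulr1 addrC.
rewrite normrM mulrAC.
have -> : mdegree alpha = (n + (\sum_(j < d | j != i) alpha j))%N.
  by rewrite /mdegree (bigD1 i).
have -> : h ^+ 2 * (n%:R ^+ 2 * s ^+ (n + (\sum_(j < d | j != i) alpha j))) =
  h ^+ 2 * (n%:R ^+ 2 * s ^+ n) * s ^+ (\sum_(j < d | j != i) alpha j).
  by rewrite exprD; ring.
apply: ler_pM => //; first by rewrite mulr_ge0// sqr_ge0.
exact: (expr_taylor2 n (ys i) xh).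
Qed.

(** [v] is the termwise derivative. A quadratic remainder, uniform on the smaller polydisc, replaces
    any interchange of limits. *)
Lemma wiener_taylor2 r M u i : 0 < r -> wiener r M u -> exists v M' C,
  [/\ wiener (r / 4) M' v, 0 <= C &
  forall y h, polydisc (r / 4) y -> polydisc (r / 4) (h *: delta_mx 0 i + y) ->
    `|u (h *: delta_mx 0 i + y) - u y - h * v y| <= h ^+ 2 * C].
Proof.
move=> r0 [c [N [cN NM hc]]].
set s := r / 4; have s0 : 0 < s by rewrite divr_gt0.
have sr y : polydisc s y -> polydisc r y.
  by move=> ys j; apply: le_trans (ys j) _; rewrite /s; lra.
have b2 (al : {ffun 'I_d -> nat}) : (al i)%:R ^+ 2 * s ^+ mdegree al <= r ^+ mdegree al.
  apply: le_trans (natr_expr4 (mdegree al) (ltW r0)).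
  rewrite ler_wpM2r ?exprn_ge0 ?(ltW s0)// lerXn2r ?nnegrE// ler_nat; exact: mdegree_ge.
have b1 (al : {ffun 'I_d -> nat}) : (al i)%:R * s ^+ mdegree (lower_index i al) <= s^-1 * r ^+ mdegree al.
  have [->|] := posnP (al i); first by rewrite mul0r mulr_ge0 ?invr_ge0 ?exprn_ge0 ?ltW.
  move=> ai; rewrite ler_pdivlMl//; apply: le_trans (b2 al).
  rewrite (mdegree_lower_index ai) (exprS s) [leLHS]mulrCA.
  rewrite ler_wpM2r//; first by rewrite mulr_ge0 ?exprn_ge0// ltW.
  by rewrite -natrX ler_nat leq_pmulr.
pose dc (al : {ffun 'I_d -> nat}) := c al * (al i)%:R.
have sV : 0 <= s^-1 by rewrite invr_ge0 ltW.
have [|N' cN' N'N] := @psum_dom _ _ (fun al => `|dc al| * s ^+ mdegree (lower_index i al)) _ _ _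
   (psumZ sV cN).
  move=> al; rewrite mulr_ge0 ?exprn_ge0 ?(ltW s0)//=.
  rewrite normrM (ger0_norm (ler0n _ _)) -mulrA mulrCA.
  by rewrite mulrCA [leRHS]mulrCA ler_wpM2l.
have hv y : polydisc s y -> exists x, has_sum (fun al => dc al * monomial y (lower_index i al)) x.
  move=> ys.
  have [|P pP _] := @psum_dom _ _ (fun al => `|dc al * monomial y (lower_index i al)|) _ _ _ cN'.
    by move=> al; rewrite normr_ge0 normrM ler_wpM2l// monomial_le.
  by have [x] := has_sum_ex pP; exists x.
have /choice[v hv'] : forall y, exists x, polydisc s y ->
     has_sum (fun al => dc al * monomial y (lower_index i al)) x.
  move=> y; have [/hv[x ?]|] := pselect (polydisc s y); first by exists x.
  by exists 0.
exists v, N', (s ^- 2 * N); split.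
- exact: (@wiener_family _ _ _ dc (lower_index i) _ _ N').
- by rewrite mulr_ge0 ?invr_ge0 ?sqr_ge0// (psum_ge0 cN).
- move=> y h ys yhs.
  have H := has_sumB (has_sumB (hc _ (sr _ yhs)) (hc _ (sr _ ys))) (has_sumZ h (hv' y ys)).
  have hs0 : 0 <= h ^+ 2 * s ^- 2 by rewrite mulr_ge0 ?sqr_ge0// invr_ge0 sqr_ge0.
  have [|P pP PN] := @psum_dom _ _ (fun al => `|c al * monomial (h *: delta_mx 0 i + y) al -
       c al * monomial y al - h * (dc al * monomial y (lower_index i al))|) _ _ _
       (psumZ hs0 cN).
    move=> al; rewrite normr_ge0/=.
    have -> : c al * monomial (h *: delta_mx 0 i + y) al - c al * monomial y al -
       h * (dc al * monomial y (lower_index i al)) =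
       c al * (monomial (h *: delta_mx 0 i + y) al - monomial y al -
       h * ((al i)%:R * monomial y (lower_index i al))) by rewrite /dc; ring.
    rewrite normrM [leRHS]mulrCA ler_wpM2l//.
    have := monomial_taylor2 al (ltW s0) ys yhs.
    rewrite -ler_pdivlMr ?exprn_gt0// => /le_trans; apply.
    by rewrite [leRHS]mulrAC ler_wpM2r ?invr_ge0 ?sqr_ge0// ler_wpM2l ?sqr_ge0.
  apply: le_trans (has_sum_le_abs H pP) _; apply: le_trans PN _.
  by rewrite mulrA.
Qed.

Lemma wiener_restrict r r' M u : 0 <= r' -> r' <= r -> wiener r M u -> wiener r' M u.
Proof.
move=> r'0 r'r [c [N [cN NM hc]]].
have [|N' cN' N'N] := @psum_dom _ _ (fun al => `|c al| * r' ^+ mdegree al) _ _ _ cN.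
  move=> al; rewrite mulr_ge0 ?exprn_ge0//= ler_wpM2l// lerXn2r// nnegrE.
  exact: le_trans r'r.
exists c, N'; split => //; first exact: le_trans NM.
by move=> y yr; apply: hc => i; exact: le_trans r'r.
Qed.

Lemma polydiscD (r s : R) y z : polydisc r y -> polydisc s z -> polydisc (r + s) (y + z).
Proof. by move=> yr zs i; rewrite mxE; apply: le_trans (ler_normD _ _) _; exact: lerD. Qed.

Lemma real_analytic_derive (g : 'rV[R]_d -> R) i : real_analytic g ->
  (forall x, derivable g x (delta_mx 0 i)) /\ real_analytic ('D_(delta_mx 0 i) g).
Proof.
move=> /real_analyticP ga.
have key a : exists r v M, [/\ 0 < r, wiener r M v &
    forall y, polydisc r y -> is_derive (a + y) (delta_mx 0 i) g (v y)].
  have [r [M [r0 gM]]] := ga a.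
  have [v [M' [C [vM' C0 hv]]]] := wiener_taylor2 i r0 gM.
  (* With [y] and the increment both within [r / 8], the two points stay in the polydisc of radius
     [r / 4] where the expansion holds. *)
  exists (r / 8), v, M'; split; first exact: divr_gt0.
    apply: (wiener_restrict _ _ vM'); lra.
  move=> y yr.
  have cv : (fun h => h^-1 *: (g (h *: delta_mx 0 i + (a + y)) - g (a + y))) @ 0^' --> v y.
    apply/cvgrPdist_le => e e0.
    have e1 : 0 < Num.min (r / 8) (e / (C + 1)).
      by rewrite lt_min !divr_gt0// ltr_wpDl.
    near=> h.
    have h0 : h != 0 by near: h; exact: nbhs_dnbhs_neq.
    have hle : `|h| <= Num.min (r / 8) (e / (C + 1)).
      near: h; apply: dnbhs0_le; exact: e1.
    have hr : `|h| <= r / 8 by apply: le_trans hle _; rewrite ge_min lexx.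
    have he : `|h| <= e / (C + 1) by apply: le_trans hle _; rewrite ge_min lexx orbT.
    have hd : polydisc (r / 8) (h *: delta_mx 0 i : 'rV[R]_d).
      move=> j; rewrite !mxE eqxx/=; case: eqP => _; rewrite ?mulr1// mulr0 normr0.
      by rewrite divr_ge0// ltW.
    have y4 : polydisc (r / 4) y by move=> j; apply: le_trans (yr j) _; lra.
    have yh4 : polydisc (r / 4) (h *: delta_mx 0 i + y).
      by have := polydiscD hd yr; rewrite (_ : r / 8 + r / 8 = r / 4) //; field.
    have := hv y h y4 yh4.
    rewrite addrCA.
    set q := g _ - g _ => H.
    have -> : v y - h^-1 *: q = - (h^-1 * (q - h * v y)).
      by rewrite /GRing.scale/=; field.
    rewrite normrN normrM normfV ler_pdivrMl ?normr_gt0//.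
    apply: le_trans H _; rewrite -(real_normK (num_real h)) expr2 -mulrA ler_wpM2l//.
    move: he; rewrite ler_pdivlMr; last by rewrite ltr_wpDl.
    by have := normr_ge0 h; nra.
  split; first by apply/cvg_ex; exists (v y).
  by rewrite /derive; apply/cvg_lim.
split=> [x|].
  have [r [v [M [r0 _ h]]]] := key x.
  have [|+ _] := h 0; last by rewrite addr0.
  by move=> j; rewrite mxE normr0 ltW.
apply/real_analyticP => a; have [r [v [M [r0 vM h]]]] := key a.
exists r, M; split => //; apply: wiener_ext vM => y yr.
by have [_ ->] := h y yr.
Unshelve. all: by end_near. Qed.

Lemma real_analytic_continuous (g : 'rV[R]_d -> R) : real_analytic g -> continuous g.
Proof.
move=> /real_analyticP ga a; have [r [M [r0 gM]]] := ga a.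
have [c [N [cN NM hc]]] := gM.
have N0 := psum_ge0 cN.
apply: (iffRL (@cvgrPdist_le _ _ _ (nbhs a) _ g (g a))) => e e0.
(* On the polydisc of radius [t * r] each term of positive degree gains a factor [t], and the
   constant terms cancel. *)
pose t := Num.min 1 (e / (N + 1)).
have t0 : 0 < t by rewrite lt_min ltr01 divr_gt0// ltr_wpDl.
have t1 : t <= 1 by rewrite ge_min lexx.
have te : t * N <= e.
  have : t <= e / (N + 1) by rewrite ge_min lexx orbT.
  rewrite ler_pdivlMr; last by rewrite ltr_wpDl.
  by move=> h; nra.
have tr0 : 0 < t * r by exact: mulr_gt0.
apply: (polydisc_nbhs tr0) => y yr /=.
have yr' : polydisc r y by move=> j; apply: le_trans (yr j) _; rewrite ger_pMl.
have zr : polydisc r (0 : 'rV[R]_d) by move=> j; rewrite mxE normr0 ltW.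
rewrite distrC -{2}[a]addr0.
have H := has_sumB (hc y yr') (hc 0 zr).
have [|P pP PN] := @psum_dom _ _ (fun al => `|c al * monomial y al - c al * monomial 0 al|) _ _ _
   (psumZ (ltW t0) cN).
  move=> al; rewrite normr_ge0/= -mulrBr normrM mulrCA ler_wpM2l//.
  have [al0|] := posnP (mdegree al).
    have ai j : al j = 0%N by apply/eqP; rewrite -leqn0 -al0 mdegree_ge.
    rewrite /monomial !big1 ?subrr ?normr0 ?mulr_ge0 ?exprn_ge0 ?ltW//;
      by move=> j _; rewrite ai expr0.
  move=> alp; rewrite [monomial 0 al](_ : _ = 0) ?subr0; last first.
    apply/eqP/prodf_eq0; move: alp; rewrite lt0n sum_nat_eq0 negb_forall => /existsP[j].
    by rewrite /= => aj; exists j => //; rewrite mxE expr0n (negbTE aj).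
  apply: le_trans (monomial_le _ yr) _; rewrite exprMn ler_wpM2r ?exprn_ge0 ?(ltW r0)//.
  by rewrite -[leRHS]expr1 ler_wiXn2l// ltW.
by apply: le_trans (has_sum_le_abs H pP) _; apply: le_trans PN te.
Qed.

Lemma real_analytic_C_n n (g : 'rV[R]_d -> R) : real_analytic g -> C_n n g.
Proof.
elim: n g => [|n ih] g ga /=; (split; first exact: real_analytic_continuous) => //.
by move=> i; have [? /ih] := real_analytic_derive i ga.
Qed.

(** The line is encoded as ['rV_1] so that the derivatives of analytic functions are available on
    it. Monomials of equal degree collapse to one power, and [wiener_family] regroups them. *)
Lemma real_analytic_line (g : 'rV[R]_d -> R) (x v : 'rV[R]_d) : real_analytic g ->
  real_analytic (fun z : 'rV[R]_1 => g (x + z 0 0 *: v)).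
Proof.
move=> /real_analyticP ga; apply/real_analyticP => a.
have [r [M [r0 [c [N [cN NM hc]]]]]] := ga (x + a 0 0 *: v).
pose nv := \sum_i `|v 0 i|.
pose r' := r / (1 + nv).
have v0 : 0 < 1 + nv by rewrite ltr_wpDr// sumr_ge0.
have r'0 : 0 < r' by exact: divr_gt0.
have vle i : `|v 0 i| <= nv by rewrite /nv (bigD1 i)//= lerDl sumr_ge0.
have pd (z : 'rV[R]_1) : polydisc r' z -> polydisc r (z 0 0 *: v).
  move=> zr i; rewrite mxE normrM.
  apply: (@le_trans _ _ (r' * (1 + nv))); last by rewrite /r' divfK// gt_eqF.
  by apply: ler_pM => //; rewrite ler_wpDl.
have mon (z : 'rV[R]_1) al : monomial (z 0 0 *: v) al = monomial v al * z 0 0 ^+ mdegree al.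
  rewrite /monomial /mdegree -prodrXr -big_split; apply: eq_bigr => i _.
  by rewrite mxE exprMn mulrC.
have mon1 (z : 'rV[R]_1) n : monomial z [ffun=> n] = z 0 0 ^+ n.
  by rewrite /monomial big_ord1 ffunE.
have deg1 n : mdegree [ffun _ : 'I_1 => n] = n by rewrite /mdegree big_ord1 ffunE.
have [|N' cN' N'N] := @psum_dom _ _ (fun al => `|c al * monomial v al| * r' ^+ mdegree al) _ _ _ cN.
  move=> al; rewrite mulr_ge0 ?exprn_ge0 ?(ltW r'0)//= normrM -mulrA ler_wpM2l//.
  have := @monomial_le _ _ r ((const_mx r' : 'rV[R]_1) 0 0 *: v) al.
  rewrite mon normrM mxE normrX [`|r'|]ger0_norm ?(ltW r'0)// => -> //.
  move=> i; have := pd (const_mx r') _ i; rewrite !mxE; apply.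
  by move=> j; rewrite mxE ger0_norm// ltW.
exists r', N; split => //.
apply: (@wiener_family _ _ _ (fun al => c al * monomial v al) (fun al => [ffun=> mdegree al]) _ _ N') => //.
  by apply: psum_ext cN' => al; rewrite deg1.
move=> z zr; have := hc _ (pd z zr).
rewrite mxE scalerDl addrA; apply: has_sum_ext => al.
by rewrite mon mon1 mulrA.
Qed.

End analytic_derive.

(** * Restriction to lines, and convexity from second derivatives *)

Section lines.
Context {R : realType}.

Lemma real_analytic_rV1 (Y : 'rV[R]_1 -> R) : real_analytic Y ->
  let phi s := Y (const_mx s) in
  (forall s, derivable phi s 1) /\
  derive1 phi = (fun s => 'D_(delta_mx 0 0) Y (const_mx s)).
Proof.
move=> Ya phi; have [dY _] := real_analytic_derive 0 Ya.
have E s : (fun h => h^-1 *: (phi (h *: 1 + s) - phi s)) =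
    (fun h => h^-1 *: (Y (h *: delta_mx 0 0 + const_mx s) - Y (const_mx s))).
  apply/funext => h; rewrite /phi; congr (_ *: (Y _ - _)).
  by apply/matrixP => i j; rewrite !ord1 !mxE.
split=> [s|]; first by rewrite /derivable E; exact: dY.
by apply/funext => s; rewrite derive1E /derive E.
Qed.

Lemma real_analytic_line_derivable (d : nat) (g : 'rV[R]_d -> R) (x v : 'rV[R]_d) :
  real_analytic g ->
  let phi s := g (x + s *: v) in
  (forall s, derivable phi s 1) /\ (forall s, derivable (derive1 phi) s 1).
Proof.
move=> ga phi.
pose Y (z : 'rV[R]_1) := g (x + z 0 0 *: v).
have Ya : real_analytic Y by exact: real_analytic_line.
have E : phi = (fun s => Y (const_mx s)) by apply/funext => s; rewrite /Y mxE.
have [h1 h2] := real_analytic_rV1 Ya.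
have [_ DYa] := real_analytic_derive 0 Ya.
have [h3 _] := real_analytic_rV1 DYa.
split=> s; rewrite E; first exact: h1.
rewrite h2; exact: h3.
Qed.

Lemma derivable_cvg (phi : R -> R) s : derivable phi s 1 -> phi x @[x --> s] --> phi s.
Proof. by move=> /derivable1_diffP/differentiable_continuous. Qed.

Lemma convex_function_setT (d : nat) (g : 'rV[R]_d -> R) :
  convex_function setT g <->
  (forall x y (t : R), 0 <= t <= 1 -> g (t *: x + (1 - t) *: y) <= t * g x + (1 - t) * g y).
Proof.
split=> [h x y t /andP[t0 t1]|h t x y _ _]; last by apply: h; rewrite ge0 le1.
by have := h (Itv01 t0 t1) x y; rewrite !inE/=; exact.
Qed.

Lemma strongly_convex_convex (d : nat) (g : 'rV[R]_d -> R) :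
  strongly_convex g -> real_analytic g -> convex_function setT g.
Proof.
move=> [_ sc] ga; apply/convex_function_setT => x y t /andP[t0 t1].
have [->|xy] := eqVneq x y; first by rewrite -scalerDl -mulrDl subrKC scale1r mul1r.
pose phi s := g (y + s *: (x - y)).
have [d1 d2] := real_analytic_line_derivable y (x - y) ga.
have D1 : 'D_1 phi = derive1 phi by apply/funext => s; rewrite derive1E.
have s0 : 0 <= 1 - t by rewrite subr_ge0.
have s1 : 1 - t <= 1 by rewrite gerBl.
(* [conv] gives its weight to the first endpoint, here 0, so the weight [1 - t] yields the point
   [t]. *)
have H : phi (conv (Itv01 s0 s1) (0 : R^o) (1 : R^o)) <= conv (Itv01 s0 s1) (phi 0 : R^o) (phi 1).
  apply: second_derivative_convex; last exact: ler01.
  - move=> z _; rewrite D1 -derive1E; apply/ltW; apply: (sc y (x - y)).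
    by rewrite subr_eq0.
  - by apply: cvg_at_left_filter; exact/derivable_cvg/d1.
  - by apply: cvg_at_right_filter; exact/derivable_cvg/d1.
  - by move=> z _; exact: d1.
  - by move=> z _; rewrite D1; exact: d2.
move: H; rewrite !convRE /= /unstable.onem subKr mulr0 add0r mulr1 /phi.
rewrite scale0r addr0 scale1r subrKC [X in _ -> _ <= X]addrC; congr (g _ <= _).
by rewrite scalerBl scalerBr scale1r addrCA.
Qed.

End lines.

(** * Strong convexity of the implicit function *)

Section second_derivative.
Context {R : realType}.

Lemma derive1_quotient (phi : R -> R) t (e : R) : derivable phi t 1 -> 0 < e ->
  exists2 del, 0 < del & forall h, h != 0 -> `|h| < del ->
    `|derive1 phi t - (phi (t + h) - phi t) / h| < e.
Proof.
move=> dphi e0.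
rewrite derive1E.
have cv : (fun h => h^-1 *: (phi (h *: 1 + t) - phi t)) @ 0^' --> 'D_1 phi t := dphi.
move/cvgrPdist_lt : cv => /(_ e e0)/nbhs_ballP[del /= del0 H].
exists del => // h h0 hd.
have := H h; rewrite /ball/= sub0r normrN => /(_ hd h0).
by rewrite /GRing.scale/= mulr1 mulrC (addrC h t).
Qed.

(** The quadratic minorant forces [m] to be the derivative. By the mean value theorem the derivative
    then gains at least [c * h] at some point closer than [h] to [t], which a nonpositive second
    derivative excludes. No formula for the second derivative is needed. *)
Lemma derive1_derive1_gt0 (phi : R -> R) (t m c eta : R) :
  0 < c -> 0 < eta -> (forall s, derivable phi s 1) -> derivable (derive1 phi) t 1 ->
  (forall h, `|h| < eta -> h * m + c * h ^+ 2 <= phi (t + h) - phi t) ->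
  0 < derive1 (derive1 phi) t.
Proof.
move=> c0 eta0 dphi ddphi H.
have m_eq : derive1 phi t = m.
  apply/eqP; rewrite eq_le; apply/andP; split; apply/ler_addgt0Pr => e e0.
    have [del del0 D] := derive1_quotient (dphi t) e0.
    pose h := - (Num.min del eta / 2).
    have mm : 0 < Num.min del eta by rewrite lt_min del0.
    have h0 : h < 0 by rewrite oppr_lt0 divr_gt0.
    have hh : `|h| < Num.min del eta by rewrite ltr0_norm// opprK ltr_pdivrMr//; lra.
    have [hd he] : `|h| < del /\ `|h| < eta by move: hh; rewrite lt_min => /andP.
    have := D h (ltr0_neq0 h0) hd; rewrite ltr_distl => /andP[_ D'].
    apply: le_trans (ltW D') _; rewrite lerD2r ler_ndivrMr//.
    by apply: le_trans (H h he); rewrite mulrC lerDl mulr_ge0 ?sqr_ge0 ?ltW.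
  have [del del0 D] := derive1_quotient (dphi t) e0.
  pose h := (Num.min del eta / 2).
  have mm : 0 < Num.min del eta by rewrite lt_min del0.
  have h0 : 0 < h by rewrite divr_gt0.
  have hh : `|h| < Num.min del eta by rewrite gtr0_norm// ltr_pdivrMr//; lra.
  have [hd he] : `|h| < del /\ `|h| < eta by move: hh; rewrite lt_min => /andP.
  have := D h (lt0r_neq0 h0) hd; rewrite distrC ltr_distl => /andP[_ D'].
  apply: le_trans (ltW D'); rewrite ler_pdivlMr//.
  by apply: le_trans (H h he); rewrite mulrC lerDl mulr_ge0 ?sqr_ge0 ?ltW.
rewrite ltNge; apply/negP => neg.
have [del del0 D] := derive1_quotient ddphi c0.
pose h := (Num.min del eta / 2).
have mm : 0 < Num.min del eta by rewrite lt_min del0.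
have h0 : 0 < h by rewrite divr_gt0.
have hh : `|h| < Num.min del eta by rewrite gtr0_norm// ltr_pdivrMr//; lra.
have [hd he] : `|h| < del /\ `|h| < eta by move: hh; rewrite lt_min => /andP.
have [xi] : exists2 xi, xi \in `]t, t + h[ & phi (t + h) - phi t = derive1 phi xi * (t + h - t).
  apply: MVT; first by rewrite ltrDl.
    by move=> z _; rewrite derive1E; exact: derivableP.
  apply: derivable_within_continuous => z _; exact: dphi.
rewrite in_itv/= => /andP[txi xit] E.
have {}E : phi (t + h) - phi t = derive1 phi xi * h by rewrite E addrC addKr.
pose k := xi - t; have k0 : 0 < k by rewrite subr_gt0.
have kh : k < h by rewrite /k ltrBlDl.
have kd : `|k| < del.
  by rewrite gtr0_norm//; apply: lt_trans kh _; rewrite -(gtr0_norm h0).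
have := D k (lt0r_neq0 k0) kd; rewrite distrC ltr_distl => /andP[_].
rewrite (_ : t + k = xi); last by rewrite /k subrKC.
have q1 : m + c * h <= derive1 phi xi.
  have := H h he; rewrite E => q.
  by rewrite -(ler_pM2r h0); apply: le_trans q; rewrite le_eqVlt; apply/orP; left; apply/eqP; ring.
rewrite ltr_pdivrMr// m_eq => q2.
have : (derive1 (derive1 phi) t + c) * k <= c * h.
  apply: (@le_trans _ _ (c * k)); first by rewrite ler_wpM2r ?(ltW k0)//; lra.
  by rewrite ler_wpM2l// ltW.
by lra.
Qed.

Lemma exp_remainder_ge0 (z : R) : 0 <= exp_remainder z.
Proof. by rewrite /exp_remainder; have := expR_ge1Dx z; lra. Qed.

(** The square of [1 + z / 2 <= expR (z / 2)], whose left side is nonnegative for [- 2 <= z]. *)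
Lemma exp_remainder_ge (z : R) : - 2 <= z -> z ^+ 2 / 4 <= exp_remainder z.
Proof.
move=> z2; rewrite /exp_remainder.
have h : (1 + z / 2) ^+ 2 <= expR (z / 2) ^+ 2.
  by rewrite lerXn2r ?nnegrE ?expR_ge0 ?expR_ge1Dx//; lra.
have E : expR (z / 2) ^+ 2 = expR z by rewrite -expRM_natl; congr expR; field.
rewrite E in h.
by rewrite (_ : z ^+ 2 / 4 = (1 + z / 2) ^+ 2 - 1 - z); [lra|field].
Qed.

End second_derivative.

Section implicit_convex.
Context {R : realType} {d : nat}.

Lemma dotpZ (xi : 'I_d -> R) k (x : 'rV[R]_d) : dotp xi (k *: x) = k * dotp xi x.
Proof. by rewrite /dotp mulr_sumr; apply: eq_bigr => j _; rewrite mxE mulrCA. Qed.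

Lemma dotp_le (xi : 'I_d -> R) (x : 'rV[R]_d) :
  `|dotp xi x| <= (\sum_k `|xi k|) * (\sum_k `|x 0 k|).
Proof.
rewrite /dotp; apply: le_trans (ler_norm_sum _ _ _) _.
rewrite mulr_suml; apply: ler_sum => k _; rewrite normrM ler_wpM2l//.
by rewrite (bigD1 k)//= lerDl sumr_ge0.
Qed.

(* Subtracting the linear parts from sum_k E k exp (z h k) = 1 leaves
   L (phi (t + h) - phi t) - h m = sum_k E k (exp (z h k) - 1 - z h k), whose
   terms i and j cannot both be o (h ^ 2) when their slopes along v differ. *)
Lemma implicit_strongly_convex (I : choiceType) (w lam : I -> R) (zeta : I -> 'I_d -> R)
    (g : 'rV[R]_d -> R) :
  (forall i, 0 <= w i) -> (forall i, 0 < lam i) ->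
  (forall x, psum (fun i => w i * expR (dotp (zeta i) x - lam i * g x)) 1) ->
  (forall a, exists rho K, 0 < rho /\
     psum (fun i => w i * expR (dotp (zeta i) a - lam i * g a + rho * exponent_size lam zeta i)) K) ->
  (forall v, v != 0 -> exists i j, [/\ 0 < w i, 0 < w j &
     dotp (zeta i) v / lam i != dotp (zeta j) v / lam j]) ->
  real_analytic g -> strongly_convex g.
Proof.
move=> w0 lam0 wg hK nd ga; split; first exact: real_analytic_C_n.
move=> x v v0 t /=.
pose phi s := g (x + s *: v).
have [d1 d2] := real_analytic_line_derivable x v ga.
set a := x + t *: v.
pose E i := w i * expR (dotp (zeta i) a - lam i * g a).
have E0 i : 0 <= E i by rewrite mulr_ge0 ?expR_ge0.
have E1 : psum E 1 by exact: wg.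
have [rho [K [rho0 aK]]] := hK a.
have EK : psum (fun i => rho^-1 * (E i * expR (rho * exponent_size lam zeta i))) (rho^-1 * K).
  apply: psumZ; first by rewrite invr_ge0 ltW.
  by apply: psum_ext aK => i; rewrite expRD mulrA.
have sz i : exponent_size lam zeta i <= rho^-1 * expR (rho * exponent_size lam zeta i).
  by rewrite mulrC; exact: le_expR_div.
have EL : exists L, psum (fun i => E i * lam i) L.
  have [|L EL _] := @psum_dom _ _ (fun i => E i * lam i) _ _ _ EK; last by exists L.
  move=> i; rewrite mulr_ge0 ?(ltW (lam0 i))//= mulrCA ler_wpM2l//.
  by apply: le_trans (sz i); rewrite /exponent_size lerDl sumr_ge0.
have [L {}EL] := EL.
pose nv := \sum_k `|v 0 k|.
have nv0 : 0 <= nv by exact: sumr_ge0.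
have [m Em] : exists m, has_sum (fun i => E i * dotp (zeta i) v) m.
  have [|P pP _] := @psum_dom _ _ (fun i => `|E i * dotp (zeta i) v|) _ _ _ (psumZ nv0 EK).
    move=> i; rewrite normr_ge0/= normrM (ger0_norm (E0 i)) [rho^-1 * _]mulrCA.
    rewrite [leRHS]mulrCA ler_wpM2l//.
    apply: le_trans (dotp_le _ _) _; rewrite mulrC ler_wpM2l//.
    by apply: le_trans (sz i); rewrite /exponent_size lerDr ltW.
  by have [m] := has_sum_ex pP; exists m.
have [i [j [wi wj ij]]] := nd v v0.
have L0 : 0 < L.
  apply: lt_le_trans (psum_term_le i EL).
  by rewrite !mulr_gt0 ?expR_gt0.
pose z h k := h * dotp (zeta k) v - lam k * (phi (t + h) - phi t).
have main h : has_sum (fun k => E k * exp_remainder (z h k)) (L * (phi (t + h) - phi t) - h * m).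
  have H1 : psum (fun k => E k * expR (z h k)) 1.
    apply: psum_ext (wg (x + (t + h) *: v)) => k.
    rewrite /E -mulrA -expRD; congr (_ * expR _).
    by rewrite /z /a !dotpD !dotpZ /phi; ring.
  have := has_sumB (has_sumB (has_sum_of_psum H1) (has_sum_of_psum E1))
     (has_sumB (has_sumZ h Em) (has_sumZ (phi (t + h) - phi t) (has_sum_of_psum EL))).
  rewrite (_ : 1 - 1 - _ = L * (phi (t + h) - phi t) - h * m); last by ring.
  by apply: has_sum_ext => k; rewrite /exp_remainder /z; ring.
have main' h k : E k * exp_remainder (z h k) <= L * (phi (t + h) - phi t) - h * m.
  apply: (@psum_term_le _ _ (fun k => E k * exp_remainder (z h k))).
  by apply: psum_of_has_sum (main h) => k'; rewrite mulr_ge0 ?exp_remainder_ge0.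
(* For small [h] both parts of [z h k] are at most 1 in absolute value, which gives the bound [- 2]
   that [exp_remainder_ge] asks for. *)
have zsmall k : exists2 eta, 0 < eta & forall h, `|h| < eta -> - 2 <= z h k.
  have /cvgrPdist_lt := derivable_cvg (d1 t).
  have l0 : 0 < (lam k)^-1 by rewrite invr_gt0.
  move=> /(_ _ l0)/nbhs_ballP[del /= del0 H].
  have s0 : 0 < 1 + `|dotp (zeta k) v| by rewrite ltr_wpDr.
  exists (Num.min del (1 + `|dotp (zeta k) v|)^-1); first by rewrite lt_min del0 invr_gt0.
  move=> h; rewrite lt_min => /andP[hd hz].
  have := H (t + h); rewrite /ball/= opprD addNKr normrN => /(_ hd).
  rewrite -/(phi _) -/(phi _) distrC => h1.
  have h2 : `|lam k * (phi (t + h) - phi t)| <= 1.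
    rewrite normrM gtr0_norm//; have := ltW h1.
    by rewrite -(ler_pM2l (lam0 k)) mulfV// gt_eqF.
  have h3 : `|h * dotp (zeta k) v| <= 1.
    rewrite normrM; apply: (@le_trans _ _ ((1 + `|dotp (zeta k) v|)^-1 * (1 + `|dotp (zeta k) v|))).
      by apply: ler_pM => //; [exact: ltW|rewrite lerDr].
    by rewrite mulVf// gt_eqF.
  rewrite /z; move: h2 h3; rewrite !ler_norml => /andP[a1 a2] /andP[b1 b2]; lra.
have [ei ei0 Hi] := zsmall i; have [ej ej0 Hj] := zsmall j.
pose kap := dotp (zeta i) v / lam i - dotp (zeta j) v / lam j.
have kap0 : 0 < kap ^+ 2 by rewrite exprn_even_gt0//= subr_eq0.
have Ei : 0 < E i by rewrite mulr_gt0 ?expR_gt0.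
have Ej : 0 < E j by rewrite mulr_gt0 ?expR_gt0.
pose e := Num.min (E i * lam i ^+ 2) (E j * lam j ^+ 2) / 4.
have e0 : 0 < e.
  apply: divr_gt0 => //; rewrite lt_min; apply/andP.
  by split; apply: mulr_gt0 => //; exact: exprn_gt0.
have eta0 : 0 < Num.min ei ej by rewrite lt_min ei0.
apply: (@derive1_derive1_gt0 _ phi t (m / L) (e * kap ^+ 2 / (4 * L)) _ _ eta0) => //.
  by apply: divr_gt0; apply: mulr_gt0.
move=> h; rewrite lt_min => /andP[hi hj].
set Del := phi (t + h) - phi t.
have qk k : - 2 <= z h k -> e <= E k * lam k ^+ 2 / 4 ->
    e * (z h k / lam k) ^+ 2 <= L * Del - h * m.
  move=> zk ek; apply: le_trans (main' h k).
  apply: (@le_trans _ _ (E k * lam k ^+ 2 / 4 * (z h k / lam k) ^+ 2)).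
    by rewrite ler_wpM2r ?sqr_ge0.
  apply: (@le_trans _ _ (E k * (z h k ^+ 2 / 4))).
    rewrite le_eqVlt; apply/orP; left; apply/eqP; field; exact: lt0r_neq0.
  by rewrite ler_wpM2l// exp_remainder_ge.
have qi := qk i (Hi h hi); have qj := qk j (Hj h hj).
have {}qi := qi (_ : e <= _); have {}qj := qj (_ : e <= _).
rewrite /e !ler_pM2r ?invr_gt0// !ge_min !lexx ?orbT in qi qj.
have {}qi := qi isT; have {}qj := qj isT.
(* Division by [lam] makes the increment of [phi] cancel in the difference; only the gap [h * kap]
   between the slopes remains. *)
have diff : z h i / lam i - z h j / lam j = h * kap.
  by rewrite /z /kap; field; rewrite !lt0r_neq0.
have fin : e * (h * kap) ^+ 2 <= 4 * (L * Del - h * m).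
  rewrite -diff; set p := z h i / lam i in qi *; set q := z h j / lam j in qj *.
  have : (p - q) ^+ 2 <= 2 * p ^+ 2 + 2 * q ^+ 2.
    by have := sqr_ge0 (p + q); nra.
  move=> /(ler_wpM2l (ltW e0)) => u; rewrite mulrDr in u.
  by rewrite -/e in qi qj; nra.
rewrite -(ler_pM2r L0).
have -> : (h * (m / L) + e * kap ^+ 2 / (4 * L) * h ^+ 2) * L = h * m + e * (h * kap) ^+ 2 / 4.
  by field; exact: lt0r_neq0.
lra.
Qed.

End implicit_convex.

Lemma continuous_sub (R : realType) (T : topologicalType) (f g : T -> R) :
  continuous f -> continuous g -> continuous (fun x => f x - g x).
Proof. by move=> cf cg x; apply: cvgB; [exact: cf|exact: cg]. Qed.

(** * Compact sublevel sets and finite nets of support planes *)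

Section compactness.
Context {R : realType} {d : nat}.
Implicit Types (c eps : 'rV[R]_d -> R).

Definition coercive c : Prop := forall B, exists r, forall x, r < `|x| -> B < c x.

Lemma compact_sublevel c B : continuous c -> coercive c -> compact [set x | c x <= B].
Proof.
move=> cc /(_ B)[r hr]; apply: bounded_closed_compact.
  exists r; split; first exact: num_real.
  move=> M rM x /= cxB; rewrite leNgt; apply/negP => Mx.
  by have := hr x (lt_trans rM Mx); rewrite ltNge cxB.
rewrite (_ : [set x | c x <= B] = c @^-1` [set y | y <= B]) //.
apply: preimage_closed => //; exact: closed_le.
Qed.

Lemma compact_pos_lb eps (K : set 'rV[R]_d) : continuous eps -> (forall x, 0 < eps x) ->
  compact K -> exists2 e, 0 < e & forall x, K x -> e <= eps x.
Proof.
move=> ce e0 cK; have [K0|] := pselect (K !=set0); last first.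
  by move=> nK; exists 1 => // x Kx; exfalso; apply: nK; exists x.
have [|x _ hx] := compact_EVT_min K0 cK (f := eps); first exact: continuous_subspaceT.
by exists (eps x) => // y Ky; apply: hx; rewrite inE.
Qed.

(** Each point lies in the open set where its own plane is within [eta] of [c]. *)
Lemma compact_net c (ell : 'rV[R]_d -> 'rV[R]_d -> R) (K : set 'rV[R]_d) eta :
  0 < eta -> continuous c -> (forall p, continuous (ell p)) -> (forall x, ell x x = c x) ->
  compact K -> exists s : seq 'rV[R]_d, forall y, K y -> exists2 p, p \in s & c y - eta < ell p y.
Proof.
move=> eta0 cc cl lx; rewrite compact_cover => cK.
have [|y Ky|D' _ H] := cK 'rV[R]_d setT (fun p => [set y | 0 < ell p y - (c y - eta)]).
- move=> p _.
  rewrite (_ : mkset _ = (fun y => ell p y - (c y - eta)) @^-1` [set y | 0 < y]) //.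
  apply: open_comp; last exact: open_gt.
  have ct : continuous (fun y => ell p y - (c y - eta)).
    by apply: continuous_sub => //; apply: continuous_sub => //; exact: cst_continuous.
  by move=> y _; exact: (ct y).
- by exists y => //=; rewrite lx; lra.
exists (finmap.enum_fset D') => y /H[p pD] /=; rewrite subr_gt0 => h.
by exists p.
Qed.

End compactness.

(** * Existence of the root [t] at a fixed point *)

Section exp_family.
Context {R : realType} {I : choiceType}.
Variables (p lam : I -> R).
Hypothesis p_ge0 : forall i, 0 <= p i.
Hypothesis lam_gt0 : forall i, 0 < lam i.

(** Intermediate values: the single term [i0] already makes the sum at least 1 at [t0]. Convergence
    a little to the left, at [t0 - s], dominates the factors [lam i] of the derivative and makes the
    sum Lipschitz. *)
Lemma exp_family_level (t0 t1 s : R) (i0 : I) S1 Ss :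
  0 < s -> t0 <= t1 -> 1 <= p i0 * expR (- (lam i0 * t0)) ->
  psum (fun i => p i * expR (- (lam i * t1))) S1 -> S1 <= 1 ->
  psum (fun i => p i * expR (- (lam i * (t0 - s)))) Ss ->
  exists2 t, t0 <= t <= t1 & psum (fun i => p i * expR (- (lam i * t))) 1.
Proof.
move=> s0 t01 i01 h1 S11 hs.
have mono t t' i : t <= t' -> p i * expR (- (lam i * t')) <= p i * expR (- (lam i * t)).
  by move=> tt; rewrite ler_wpM2l// ler_expR lerN2 ler_wpM2l// ltW.
have nneg t i : 0 <= p i * expR (- (lam i * t)) by rewrite mulr_ge0 ?expR_ge0.
have ex t : t0 <= t -> exists S, psum (fun i => p i * expR (- (lam i * t))) S.
  move=> tt; have [|S hS _] := @psum_dom _ _ (fun i => p i * expR (- (lam i * t))) _ _ _ hs.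
    by move=> i; rewrite nneg/= mono//; lra.
  by exists S.
have tmax t : t0 <= Num.max t0 t by rewrite le_max lexx.
(* Clamping at [t0] turns the sum into a total function; the root lies in the unclamped range. *)
have /choice[S hS] : forall t, exists S, psum (fun i => p i * expR (- (lam i * Num.max t0 t))) S.
  by move=> t; exact: ex.
have Ss0 := psum_ge0 hs.
have lip t t' : t <= t' -> 0 <= S t - S t' <= s^-1 * Ss * (t' - t).
  move=> tt'.
  have mm : Num.max t0 t <= Num.max t0 t' by rewrite ge_max !le_max lexx tt' orbT.
  have H := has_sumB (has_sum_of_psum (hS t)) (has_sum_of_psum (hS t')).
  have {}H := psum_of_has_sum _ H.
  have {}H : psum (fun i => p i * expR (- (lam i * Num.max t0 t)) - p i * expR (- (lam i * Num.max t0 t'))) (S t - S t').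
    by apply: H => i; rewrite subr_ge0 mono.
  apply/andP; split; first exact: psum_ge0 H.
  have k0 : 0 <= s^-1 * (t' - t) by rewrite mulr_ge0 ?invr_ge0 ?subr_ge0// ltW.
  rewrite mulrAC; apply: psum_le H (psumZ k0 hs) => i.
  set u := Num.max t0 t in mm *; set u' := Num.max t0 t' in mm *.
  have uu : u' - u <= t' - t.
    by rewrite /u /u'; case: (leP t0 t) => a1; case: (leP t0 t') => a2; lra.
  rewrite -mulrBr mulrCA ler_wpM2l//.
  have -> : expR (- (lam i * u)) - expR (- (lam i * u')) =
     expR (- (lam i * u)) * (1 - expR (- (lam i * (u' - u)))).
    by rewrite mulrBr mulr1 -expRD; congr (_ - expR _); ring.
  have e1 : 1 - expR (- (lam i * (u' - u))) <= lam i * (t' - t).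
    apply: (@le_trans _ _ (lam i * (u' - u))); last by rewrite ler_wpM2l// ltW.
    by have := expR_ge1Dx (- (lam i * (u' - u))); lra.
  have e2 : expR (- (lam i * u)) * lam i <= s^-1 * expR (- (lam i * (t0 - s))).
    apply: (@le_trans _ _ (expR (- (lam i * t0)) * (expR (s * lam i) / s))).
      apply: ler_pM; rewrite ?expR_ge0 ?(ltW (lam_gt0 _))//.
        by rewrite ler_expR lerN2 ler_wpM2l ?(ltW (lam_gt0 _))// /u le_max lexx.
      exact: le_expR_div.
    rewrite mulrA -expRD mulrC le_eqVlt; apply/orP; left; apply/eqP.
    by congr (_ * expR _); ring.
  apply: (@le_trans _ _ (expR (- (lam i * u)) * (lam i * (t' - t)))).
    by rewrite ler_wpM2l ?expR_ge0.
  rewrite mulrA [leRHS]mulrAC ler_wpM2r// subr_ge0.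
  exact: tt'.
have cS : continuous S.
  move=> t; apply/cvgrPdist_le => e e0.
  pose C := s^-1 * Ss + 1.
  have C0 : 0 < C by rewrite ltr_wpDl// mulr_ge0 ?invr_ge0// ltW.
  apply/nbhs_ballP; exists (e / C); first exact: divr_gt0.
  move=> t' /ltW; rewrite ler_pdivlMr// => tt'.
  have D a b : a <= b -> `|a - b| * C <= e -> `|S a - S b| <= e.
    move=> ab abe; have /andP[l1 l2] := lip a b ab.
    rewrite ger0_norm//; apply: le_trans l2 _; apply: le_trans abe.
    rewrite ler0_norm ?subr_le0// opprB mulrC ler_wpM2l ?subr_ge0//.
    by rewrite /C lerDl.
  have [ab|/ltW ab] := leP t t'; first exact: D.
  by rewrite distrC; apply: D => //; rewrite distrC.
have S0 : 1 <= S t0.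
  apply: le_trans i01 _; have := psum_term_le i0 (hS t0).
  by rewrite maxxx.
have S1' : S t1 <= 1.
  have := hS t1; rewrite (max_idPr t01) => h.
  by rewrite (psum_unique h h1).
have [|t] := @IVT R S t0 t1 1 t01 (continuous_subspaceT cS).
  by rewrite ge_min le_max S0 S1' orbT.
rewrite in_itv/= => /[dup] tt /andP[tt0 _] St; exists t => //.
by have := hS t; rewrite (max_idPr tt0) St.
Qed.

End exp_family.

(** * The construction *)

Section construction.
Context {R : realType} {d : nat}.

Lemma dotp_polydisc (xi : 'I_d -> R) r (y : 'rV[R]_d) : polydisc r y ->
  `|dotp xi y| <= r * \sum_m `|xi m|.
Proof.
move=> yr; rewrite /dotp mulr_sumr; apply: le_trans (ler_norm_sum _ _ _) _.
by apply: ler_sum => m _; rewrite normrM mulrC ler_wpM2r.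
Qed.

Lemma dotpN (xi : 'I_d -> R) (x : 'rV[R]_d) : dotp xi (- x) = - dotp xi x.
Proof. by rewrite -scaleN1r dotpZ mulN1r. Qed.

Lemma dotp_continuous (xi : 'I_d -> R) : continuous (dotp xi : 'rV[R]_d -> R).
Proof.
move=> a; apply: (iffRL (@cvgrPdist_le _ _ _ (nbhs a) _ _ (dotp xi a))) => e e0.
pose M := \sum_m `|xi m| + 1.
have M0 : 0 < M by rewrite ltr_wpDl// sumr_ge0.
apply: (@polydisc_nbhs _ _ a _ (e / M)); first exact: divr_gt0.
move=> y yr /=; rewrite dotpD opprD addNKr normrN.
apply: le_trans (dotp_polydisc _ yr) _.
rewrite -[leRHS](divfK (lt0r_neq0 M0)) ler_wpM2l ?divr_ge0 ?(ltW e0) ?(ltW M0)// /M.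
by rewrite lerDl.
Qed.

Lemma continuous_add (T : topologicalType) (f g : T -> R) :
  continuous f -> continuous g -> continuous (fun x => f x + g x).
Proof. by move=> cf cg x; apply: cvgD; [exact: cf|exact: cg]. Qed.

Lemma expR_natr_le n : expR (- n%:R) <= 2^-1 ^+ n :> R.
Proof.
rewrite -mulrN1 expRM_natl lerXn2r// ?nnegrE ?expR_ge0//.
rewrite expRN lef_pV2 ?posrE ?expR_gt0//.
by apply: le_trans (expR_ge1Dx _).
Qed.

(** The target is [c + dotp l + kappa]: the linear form that was removed for coercivity and the
    constant that makes [c] nonnegative are put back. Nonnegativity caps the surplus
    [del j * (j - c)] of a tilted plane. *)
Variables (c eps : 'rV[R]_d -> R) (l : 'I_d -> R) (kappa : R) (sg : 'rV[R]_d -> 'I_d -> R).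
Hypothesis c_cont : continuous c.
Hypothesis c_coercive : coercive c.
Hypothesis c_ge0 : forall x, 0 <= c x.
Hypothesis eps_cont : continuous eps.
Hypothesis eps_gt0 : forall x, 0 < eps x.
Hypothesis sgP : forall p y, c p + dotp (sg p) (y - p) <= c y.

(** The factor 2 leaves a margin of [e j] between the planes of level [j] and the target plus [eps].
    The bound [j.+1%:R^-1] makes the surplus of far planes tend to 0. *)
Let e_exists : exists e : nat -> R, forall j, [/\ 0 < e j, e j <= j.+1%:R^-1 &
  forall x, c x <= j.+1%:R -> 2 * e j <= eps x].
Proof.
suff /choice[e he] : forall j : nat, exists ej : R, [/\ 0 < ej, ej <= j.+1%:R^-1 &
  forall x, c x <= j.+1%:R -> 2 * ej <= eps x] by exists e.
move=> j; have [e e0 he] := compact_pos_lb eps_cont eps_gt0 (compact_sublevel (B := j.+1%:R) c_cont c_coercive).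
exists (Num.min (e / 2) j.+1%:R^-1); split.
- by rewrite lt_min divr_gt0//= invr_gt0.
- by rewrite ge_min lexx orbT.
- move=> x /he ex; have : Num.min (e / 2) j.+1%:R^-1 <= e / 2 by rewrite ge_min lexx.
  by lra.
Qed.

Let e := projT1 (cid e_exists).
Let eP := projT2 (cid e_exists).

(** The largest surplus [del j * j] and a margin [del j] add up to [e j]. *)
Let del j : R := e j / j.+1%:R.

Let e_gt0 j : 0 < e j. Proof. by have [] := eP j. Qed.
Let e_le j : e j <= j.+1%:R^-1. Proof. by have [] := eP j. Qed.
Let e_eps j x : c x <= j.+1%:R -> 2 * e j <= eps x.
Proof. by have [_ _] := eP j; apply. Qed.

Let del_gt0 j : 0 < del j. Proof. by rewrite divr_gt0. Qed.

Let del_mul j : del j * j%:R + del j = e j.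
Proof. by rewrite -[X in _ + X]mulr1 -mulrDr natr1 divfK. Qed.

Let del_mul_le j : del j * j%:R <= e j.
Proof. by rewrite -del_mul lerDl ltW. Qed.

Let del_le j : del j <= j.+1%:R^-1.
Proof.
apply: le_trans (e_le j); rewrite -[leRHS]del_mul lerDr.
by rewrite mulr_ge0// ltW.
Qed.

Let del_le1 j : del j <= 1.
Proof. by apply: le_trans (del_le j) _; rewrite invf_le1// ler1n. Qed.

(** The accuracy is half of the gain [del j] that the tilt brings on [c <= j - 1], so tilted planes
    stay strictly above [c] there. *)
Let net : exists s : nat -> seq 'rV[R]_d, forall j y, c y <= j%:R ->
  exists2 p, p \in s j & c y - del j / 2 < c p + dotp (sg p) (y - p).
Proof.
suff /choice[s hs] : forall j : nat, exists s : seq 'rV[R]_d, forall y, c y <= j%:R ->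
  exists2 p, p \in s & c y - del j / 2 < c p + dotp (sg p) (y - p) by exists s.
move=> j; apply: (@compact_net _ _ c (fun p y => c p + dotp (sg p) (y - p))) => //.
- by rewrite divr_gt0.
- move=> p; apply: continuous_add; first exact: cst_continuous.
  rewrite (_ : (fun y => _) = (fun y => dotp (sg p) y - dotp (sg p) p)); last first.
    by apply/funext => y; rewrite dotpD dotpN.
  by apply: continuous_sub; [exact: dotp_continuous|exact: cst_continuous].
- by move=> x; rewrite subrr /dotp big1 ?addr0// => i _; rewrite mxE mulr0.
- exact: compact_sublevel.
Qed.

Let s := projT1 (cid net).
Let sP := projT2 (cid net).

Let Idx : choiceType := (nat * nat)%type.
(** Indexing by all pairs gives a product of geometric series as majorant. Pairs beyond the end of a
    net have the default point 0 and are removed by the weight 0. *)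
Let valid (i : Idx) := (i.2 < size (s i.1))%N.
Let pt (i : Idx) : 'rV[R]_d := nth 0 (s i.1) i.2.
(* Lt i is (1 - del j) (support plane of c) + del j * j, plus l and kappa: the
   support plane is tilted towards the level j, which leaves it above c only on
   c < j, by at most e j, and makes it exceed c by del j on c <= j - 1. *)
Let slope (i : Idx) m : R := (1 - del i.1) * sg (pt i) m + l m.
Let cst0 (i : Idx) : R := (1 - del i.1) * (c (pt i) - dotp (sg (pt i)) (pt i)) + del i.1 * i.1%:R + kappa.
Let Lt i x : R := cst0 i + dotp (slope i) x.
(** A margin [del j] becomes the factor [expR (- (j + k + 2))], below the term [2^-(j+1) * 2^-(k+1)]
    of a family with sum 1. *)
Let lam (i : Idx) : R := (i.1.+1 + i.2.+1)%:R / del i.1.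
Let w (i : Idx) : R := if valid i then expR (lam i * cst0 i) else 0.
Let zeta (i : Idx) m : R := lam i * slope i m.
Let F x : R := c x + dotp l x + kappa.

Let lam_gt0 i : 0 < lam i. Proof. by rewrite divr_gt0// ltr0n. Qed.
Let w_ge0 i : 0 <= w i. Proof. by rewrite /w; case: ifP => // _; exact: expR_ge0. Qed.

Let dotp_zeta i x : dotp (zeta i) x = lam i * dotp (slope i) x.
Proof. by rewrite /dotp mulr_sumr; apply: eq_bigr => m _; rewrite mulrA. Qed.

Let LtE i x : Lt i x =
  (1 - del i.1) * (c (pt i) + dotp (sg (pt i)) (x - pt i)) + del i.1 * i.1%:R + dotp l x + kappa.
Proof.
rewrite /Lt /cst0 dotpD dotpN.
have -> : dotp (slope i) x = (1 - del i.1) * dotp (sg (pt i)) x + dotp l x.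
  rewrite /dotp mulr_sumr -big_split; apply: eq_bigr => m _ /=.
  by rewrite /slope; ring.
by ring.
Qed.

Let termE i x t u : w i * expR (dotp (zeta i) x - lam i * t + u) =
  if valid i then expR (lam i * (Lt i x - t) + u) else 0.
Proof.
rewrite /w; case: ifP => _; last by rewrite mul0r.
by rewrite -expRD dotp_zeta /Lt; congr expR; ring.
Qed.

Let Lt_upper i x : Lt i x <= F x + del i.1 * (i.1%:R - c x).
Proof.
rewrite LtE /F.
have h : (1 - del i.1) * (c (pt i) + dotp (sg (pt i)) (x - pt i)) <= (1 - del i.1) * c x.
  by rewrite ler_wpM2l ?subr_ge0.
lra.
Qed.

Let Lt_upper1 i x : Lt i x <= F x + e i.1.
Proof.
apply: le_trans (Lt_upper i x) _; rewrite lerD2l.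
apply: le_trans (del_mul_le i.1).
by rewrite ler_wpM2l ?(ltW (del_gt0 _))// gerBl.
Qed.

(** Up to the level [j + 1] the margin comes from [2 * e j <= eps x]; beyond it the tilt alone puts
    the plane [del j] below [F]. *)
Let Lt_upper2 i x : Lt i x - (F x + eps x) <= - del i.1.
Proof.
have [cx|cx] := leP (c x) i.1.+1%:R.
  have := e_eps cx; have := Lt_upper1 i x; have := del_mul i.1.
  have : 0 <= del i.1 * i.1%:R by rewrite mulr_ge0// ltW.
  have := e_gt0 i.1.
  by move=> *; lra.
have := Lt_upper i x.
have : del i.1 * (i.1%:R - c x) <= del i.1 * (- 1).
  rewrite ler_wpM2l ?(ltW (del_gt0 _))//; move: cx; rewrite -natr1; lra.
by have := eps_gt0 x; lra.
Qed.

Let Lt_lower x : exists i, valid i /\ F x < Lt i x.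
Proof.
(* One unit makes up for the truncation, the other puts [x] in the region [c <= j - 1] where the
   tilt gains. *)
pose j := (Num.trunc (c x)).+2.
have cj : c x + 1 <= j%:R.
  have := truncnS_gt (c x); rewrite /j -natr1 => h.
  have : (Num.trunc (c x)).+2%:R = (Num.trunc (c x))%:R + 1 + 1 :> R by rewrite !natr1.
  by move=> ->; lra.
have [|p ps hp] := sP (j := j) (y := x); first by lra.
exists (j, index p (s j)); split; first by rewrite /valid/= index_mem.
rewrite LtE /F/= /pt/= nth_index//.
set q := _ + dotp (sg p) _ in hp *.
have h : (1 - del j) * (c x - del j / 2) <= (1 - del j) * q.
  by rewrite ler_wpM2l ?subr_ge0// ltW.
have h2 : del j * 1 <= del j * (j%:R - c x).
  by rewrite ler_wpM2l ?(ltW (del_gt0 _))//; lra.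
have := del_gt0 j; have := sqr_ge0 (del j); nra.
Qed.

Let G (i : Idx) : R := 2^-1 ^+ i.1.+1 * 2^-1 ^+ i.2.+1.
Let G1 : psum G 1.
Proof.
rewrite -[X in psum _ X]mulr1; exact: psumM psum_geometric_half psum_geometric_half.
Qed.
Let G_gt0 i : 0 < G i. Proof. by rewrite mulr_gt0// exprn_gt0// invr_gt0. Qed.

Let expR_G (i : Idx) (x : R) : x <= - (i.1.+1 + i.2.+1)%:R -> expR x <= G i.
Proof.
by move=> h; rewrite /G -exprD; apply: le_trans (expR_natr_le _); rewrite ler_expR.
Qed.

Let F_cont : continuous F.
Proof.
apply: continuous_add; last exact: cst_continuous.
by apply: continuous_add => //; exact: dotp_continuous.
Qed.

(** Far planes exceed [F] near [a] by at most [e j], which tends to 0, so the gap [tau - F a] makes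
    their terms decay; finitely many indices remain, and for them only a constant is lost. *)
Let summable_above a tau : F a < tau -> exists rho K, 0 < rho /\
  psum (fun i => w i * expR (dotp (zeta i) a - lam i * tau + rho * exponent_size lam zeta i)) K.
Proof.
move=> Ftau; pose gam := tau - F a; have gam0 : 0 < gam by rewrite subr_gt0.
have gam4 : 0 < gam / 4 by rewrite divr_gt0.
have [r r0 hr] : exists2 r, 0 < r & forall y, polydisc r y -> F (a + y) <= F a + gam / 4.
  have /(iffLR (@cvgrPdist_le _ _ _ (nbhs a) _ _ (F a)))/(_ _ gam4) := F_cont (x := a).
  move=> /nbhs_polydisc[r r0 h]; exists r => // y /h /=.
  by rewrite ler_norml => /andP[+ _]; lra.
pose rho := Num.min r (gam / 4).
have rho0 : 0 < rho by rewrite lt_min r0.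
have rho4 : rho <= gam / 4 by rewrite ge_min lexx orbT.
pose term (i : Idx) := w i * expR (dotp (zeta i) a - lam i * tau + rho * exponent_size lam zeta i).
have term0 i : 0 <= term i by rewrite mulr_ge0 ?expR_ge0.
(* From level [J] on, a quarter of the gap bounds both the surplus [e j] and the margin [del j]. *)
pose J := Num.trunc ((gam / 4)^-1).
have Jle j : (J <= j)%N -> j.+1%:R^-1 <= gam / 4.
  move=> Jj; rewrite -[leRHS]invrK lef_pV2 ?posrE ?ltr0n ?invr_gt0//.
  apply: ltW; apply: lt_le_trans (truncnS_gt _) _.
  by rewrite ler_nat ltnS.
have expo i : lam i * (Lt i a - tau) + rho * exponent_size lam zeta i <=
    lam i * (- (gam / 2) + i.1.+1%:R^-1).
  have -> : exponent_size lam zeta i = lam i * (1 + \sum_m `|slope i m|).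
    rewrite /exponent_size mulrDr mulr1 mulr_sumr; congr (_ + _).
    by apply: eq_bigr => m _; rewrite /zeta normrM gtr0_norm.
  rewrite mulrCA -mulrDr ler_wpM2l ?(ltW (lam_gt0 _))//.
  (* At this point of the polydisc the affine form takes its maximum, so that
     the growth of the slopes is controlled by F near a. *)
  pose y : 'rV[R]_d := \row_m (rho * Num.sg (slope i m)).
  have yr : polydisc r y.
    move=> m; rewrite mxE normrM gtr0_norm// normr_sg.
    apply: (@le_trans _ _ rho); last by rewrite ge_min lexx.
    by rewrite ler_piMr ?(ltW rho0)//; case: (slope i m != 0); rewrite ?lexx.
  have dy : dotp (slope i) y = rho * \sum_m `|slope i m|.
    rewrite /dotp mulr_sumr; apply: eq_bigr => m _.
    by rewrite mxE mulrCA normrEsg [slope i m * _]mulrC.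
  have h1 : Lt i (a + y) = Lt i a + rho * \sum_m `|slope i m|.
    by rewrite /Lt dotpD dy addrA.
  have := hr y yr; have := Lt_upper1 i (a + y); rewrite h1; have := e_le i.1.
  have gamE : gam = tau - F a by [].
  (* One quarter of the gap pays for the variation of [F] near [a], another for [rho * lam i]; half
     of it remains. *)
  have aux (L S g q rh f f' e' t : R) : g = t - f -> rh <= g / 4 -> e' <= q ->
      L + rh * S <= f' + e' -> f' <= f + g / 4 -> L - t + rh * (1 + S) <= - (g / 2) + q.
    by move=> *; rewrite mulrDr mulr1; lra.
  exact: aux.
have far i : (J <= i.1)%N -> term i <= G i.
  move=> /Jle Ji; rewrite /term termE; case: ifP => _; last exact: ltW.
  apply: expR_G; apply: le_trans (expo i) _.
  apply: (@le_trans _ _ (lam i * (- (gam / 4)))).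
    rewrite ler_wpM2l ?(ltW (lam_gt0 _))//; move: Ji.
    by move: (i.1.+1%:R^-1) => q; lra.
  rewrite mulrN lerN2 /lam mulrAC ler_pdivlMr// ler_wpM2l//.
  exact: le_trans (del_le _) Ji.
(* [Q] dominates every ratio [term i / G i] of the finitely many valid indices below level [J]. *)
pose Q := 1 + \sum_(j < J) \sum_(k < size (s j)) (term (nat_of_ord j, nat_of_ord k) / G (nat_of_ord j, nat_of_ord k)).
have q0 i : 0 <= term i / G i by rewrite divr_ge0// ltW.
have Q1 : 1 <= Q by rewrite lerDl sumr_ge0// => j _; rewrite sumr_ge0.
have all i : term i <= Q * G i.
  have [Ji|iJ] := leqP J i.1.
    by apply: le_trans (far i Ji) _; rewrite ler_peMl// ltW.
  have [vi|nvi] := boolP (valid i); last first.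
    by rewrite /term termE (negbTE nvi) mulr_ge0 ?(ltW (G_gt0 _))// (le_trans _ Q1).
  rewrite -ler_pdivrMr//; case: i iJ vi => j k /= jJ kv.
  rewrite /Q (bigD1 (Ordinal jJ))//= (bigD1 (Ordinal kv))//=.
  set q := term (j, k) / G (j, k); set A := \sum_(_ < size (s j) | _) _.
  set B := \sum_(_ < J | _) _.
  have A0 : 0 <= A by apply: sumr_ge0 => k' _.
  have B0 : 0 <= B by apply: sumr_ge0 => j' _; apply: sumr_ge0 => k' _.
  by clearbody q A B; lra.
have Q0 : 0 <= Q by exact: le_trans Q1.
have [|K hK _] := @psum_dom _ _ term _ _ _ (psumZ Q0 G1).
  by move=> i; rewrite term0 all.
by exists rho, K.
Qed.

Let solve x : exists t, F x < t <= F x + eps x /\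
  psum (fun i => w i * expR (dotp (zeta i) x - lam i * t)) 1.
Proof.
have [i0 [v0 Fi0]] := Lt_lower x.
pose p i := w i * expR (dotp (zeta i) x).
have p0 i : 0 <= p i by rewrite mulr_ge0 ?expR_ge0.
have pE i t : p i * expR (- (lam i * t)) = w i * expR (dotp (zeta i) x - lam i * t).
  by rewrite /p -mulrA -expRD.
have t01 : Lt i0 x <= F x + eps x by have := Lt_upper2 i0 x; have := del_gt0 i0.1; lra.
have h0 : 1 <= p i0 * expR (- (lam i0 * Lt i0 x)).
  by rewrite pE -[_ - _]addr0 termE v0 subrr mulr0 addr0 expR0.
have [|S1 hS1 S11] := @psum_dom _ _ (fun i => p i * expR (- (lam i * (F x + eps x)))) _ _ _ G1.
  move=> i; rewrite mulr_ge0 ?expR_ge0//= pE -[_ - _]addr0 termE.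
  case: ifP => _; last exact: ltW.
  apply: expR_G; rewrite addr0.
  have := ler_wpM2l (ltW (lam_gt0 i)) (Lt_upper2 i x).
  by rewrite mulrN {2}/lam divfK// gt_eqF.
(* Half of the strict gap, so that [Lt i0 x - sh] is still above [F x] and the sum converges
   there. *)
pose sh := (Lt i0 x - F x) / 2.
have sh0 : 0 < sh by rewrite divr_gt0// subr_gt0.
have [|rho [K [rho0 hK]]] := @summable_above x (Lt i0 x - sh); first by rewrite /sh; lra.
have [|Ss hSs _] := @psum_dom _ _ (fun i => p i * expR (- (lam i * (Lt i0 x - sh)))) _ _ _ hK.
  move=> i; rewrite mulr_ge0 ?expR_ge0//= pE ler_wpM2l// ler_expR lerDl.
  by rewrite mulr_ge0 ?(ltW rho0)// addr_ge0 ?sumr_ge0// ltW.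
have [t /andP[t0 t1] ht] := exp_family_level p0 lam_gt0 sh0 t01 h0 hS1 S11 hSs.
exists t; split; first by rewrite (lt_le_trans Fi0).
by apply: psum_ext ht => i; rewrite pE.
Qed.

Lemma analytic_fine_approximation : exists g : 'rV[R]_d -> R,
  [/\ strongly_convex g, real_analytic g &
   forall x, `|c x + dotp l x + kappa - g x| <= eps x].
Proof.
have /choice[g hg] := solve.
have g1 x : psum (fun i => w i * expR (dotp (zeta i) x - lam i * g x)) 1 by have [] := hg x.
have gF x : F x < g x <= F x + eps x by have [] := hg x.
have gK a : exists rho K, 0 < rho /\
    psum (fun i => w i * expR (dotp (zeta i) a - lam i * g a + rho * exponent_size lam zeta i)) K.
  by apply: summable_above; case/andP: (gF a).
have ga : real_analytic g by exact: implicit_analytic g1 gK.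
exists g; split => //; last first.
  move=> x; have /andP[h1 h2] := gF x; rewrite -/(F x) ler_norml; apply/andP; split; lra.
apply: (implicit_strongly_convex w_ge0 lam_gt0 g1 gK _ ga) => v v0.
apply: contrapT => /forallNP H.
have [i0 [vi0 _]] := Lt_lower 0.
have wpos i : valid i -> 0 < w i by rewrite /w => ->; exact: expR_gt0.
have zs i : dotp (zeta i) v / lam i = dotp (slope i) v.
  by rewrite dotp_zeta mulrAC mulfV ?mul1r// gt_eqF.
have same i : valid i -> dotp (slope i) v = dotp (slope i0) v.
  move=> vi; apply/eqP/negPn/negP => ne; apply: (H i); exists i0.
  by split; [exact: wpos|exact: wpos|rewrite !zs].
(* If all planes had the same slope along [v], a plane above [F] at [t *: v], compared with its
   value at 0, would bound [c] on the half-line where [t * b <= 0], against coercivity. *)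
pose b := dotp (slope i0) v - dotp l v.
have bound t : t * b <= 0 -> c (t *: v) <= c 0 + 1.
  move=> tb; have [i [vi Fi]] := Lt_lower (t *: v).
  have := Lt_upper1 i 0; rewrite /Lt /F in Fi *.
  have z0 (xi : 'I_d -> R) : dotp xi (0 : 'rV[R]_d) = 0.
    by rewrite /dotp big1// => m _; rewrite mxE mulr0.
  rewrite !z0 !addr0 => h0.
  move: Fi; rewrite !dotpZ same// => Fi.
  have e1 : e i.1 <= 1 by apply: le_trans (e_le _) _; rewrite invf_le1// ler1n.
  by move: tb; rewrite /b mulrBr => tb; lra.
have [r hr] := c_coercive (c 0 + 1).
have nv : 0 < `|v| by rewrite normr_gt0.
pose T := (`|r| + 1) / `|v|.
have T0 : 0 < T by rewrite divr_gt0// ltr_wpDl.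
have big t : `|t| = T -> r < `|t *: v|.
  move=> tT; rewrite normrZ tT /T divfK ?gt_eqF//.
  by have := ler_norm r; lra.
have [b0|b0] := leP b 0.
  have := bound T; rewrite pmulr_rle0// => /(_ b0); rewrite leNgt => /negP; apply.
  by apply: hr; apply: big; rewrite gtr0_norm.
have := bound (- T); rewrite mulNr oppr_le0 => /(_ (ltW (mulr_gt0 T0 b0))).
rewrite leNgt => /negP; apply.
by apply: hr; apply: big; rewrite normrN gtr0_norm.
Qed.

End construction.

(** * Subgradients and degenerate directions *)

Lemma continuous_sum_norm (R : realType) (T : topologicalType) (J : Type) (X : seq J)
  (a : J -> T -> R) : (forall j, continuous (a j)) ->
  continuous (fun v => \sum_(j <- X) `|a j v|).
Proof.
move=> ca; elim: X => [|j X ih].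
  by under eq_fun do rewrite big_nil; exact: cst_continuous.
under eq_fun do rewrite big_cons.
apply: continuous_add => // v; apply: cvg_norm; exact: ca.
Qed.

(** The terms sum to zero, so the positive ones carry half of the absolute sum, and one of them
    reaches the average. *)
Lemma exists_large_term (R : realFieldType) (J : eqType) (X : seq J) (a : J -> R) :
  (0 < size X)%N -> \sum_(j <- X) a j = 0 ->
  exists2 j, j \in X & (\sum_(j <- X) `|a j|) / (2 * (size X)%:R) <= a j.
Proof.
move=> X0 sum0; apply: contrapT => H.
set M := \sum_(j <- X) `|a j|; set b := M / (2 * (size X)%:R).
have N0 : 0 < (size X)%:R :> R by rewrite ltr0n.
have hX : has (fun j => j \in X) X.
  by case: X X0 {sum0 H M b N0} => // x X _; rewrite /= mem_head.
have lt j : j \in X -> a j < b.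
  by move=> jX; rewrite ltNge; apply/negP => h; apply: H; exists j.
have sumc (k : R) : \sum_(j <- X) k = (size X)%:R * k.
  by rewrite big_const_seq count_predT iter_addr_0 mulr_natl.
have b0 : 0 < b.
  rewrite -(pmulr_rgt0 _ N0) -sumc -[X in X < _]sum0 [X in X < _]big_seq [X in _ < X]big_seq.
  exact: ltr_sum.
have : M < (size X)%:R * (2 * b).
  rewrite -sumc -[M]addr0 -[X in M + X]sum0 /M -big_split/= [X in X < _]big_seq [X in _ < X]big_seq.
  apply: ltr_sum => // j /lt jb.
  by have [a0|a0] := leP 0 (a j); [rewrite ger0_norm//|rewrite ltr0_norm//]; lra.
rewrite (_ : (size X)%:R * (2 * b) = M) ?ltxx//.
by rewrite /b; field; exact: lt0r_neq0.
Qed.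

Section subgradient.
Context {R : realType} {d : nat}.
Variable f : 'rV[R]_d -> R.
Hypothesis f_convex : convex_function setT f.

Let cf x y (t : R) : 0 <= t <= 1 -> f (t *: x + (1 - t) *: y) <= t * f x + (1 - t) * f y.
Proof. by move=> t01; exact: (iffLR (convex_function_setT f) f_convex). Qed.

Let supported (k : nat) (y : 'rV[R]_d) := forall i : 'I_d, (k <= i)%N -> y 0 i = 0.

Let supported_comb k a b y z : supported k y -> supported k z -> supported k (a *: y + b *: z).
Proof. by move=> hy hz i ki; rewrite !mxE hy// hz// !mulr0 addr0. Qed.

(** The Hahn-Banach step: a linear minorant on the first [k] coordinates extends by a slope between
    the left and right difference quotients along the next one. For [d <= k] nothing is left to
    extend. *)
Let subgradient_step x k (xi : 'I_d -> R) :
  (forall y, supported k y -> f x + dotp xi y <= f (x + y)) ->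
  exists xi', forall y, supported k.+1 y -> f x + dotp xi' y <= f (x + y).
Proof.
move=> H; have [dk|kd] := leqP d k.
  exists xi => y _; apply: H => i ki; exfalso.
  by have := leq_trans dk ki; rewrite leqNgt ltn_ord.
pose i0 := Ordinal kd.
pose e : 'rV[R]_d := delta_mx 0 i0.
have key y1 y2 s t : supported k y1 -> supported k y2 -> 0 < s -> 0 < t ->
    (f x + dotp xi y1 - f (x + y1 - s *: e)) / s <= (f (x + y2 + t *: e) - f x - dotp xi y2) / t.
  move=> h1 h2 s0 t0.
  have st0 : 0 < s + t by exact: addr_gt0.
  have stn : s + t != 0 by exact: lt0r_neq0.
  (* With this weight the components along [e] cancel, and the minorant on the smaller space
     applies. *)
  pose a := t / (s + t).
  have a1 : 1 - a = s / (s + t) by rewrite /a; field.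
  have a01 : 0 <= a <= 1.
    by apply/andP; split; [|rewrite -subr_ge0 a1]; rewrite divr_ge0// ltW.
  have := cf (x + y1 - s *: e) (x + y2 + t *: e) a01.
  have -> : a *: (x + y1 - s *: e) + (1 - a) *: (x + y2 + t *: e) =
      x + (a *: y1 + (1 - a) *: y2).
    apply/rowP => i; rewrite !mxE a1 /a; field.
    exact: stn.
  have := H _ (supported_comb a (1 - a) h1 h2).
  rewrite dotpD !dotpZ => l1 l2.
  rewrite ler_pdivrMr// mulrAC ler_pdivlMr//.
  have := le_trans l1 l2; rewrite a1 /a => l3.
  have := ler_wpM2r (ltW st0) l3.
  set A := f (x + y1 - s *: e); set B := f (x + y2 + t *: e).
  have -> : (t / (s + t) * A + s / (s + t) * B) * (s + t) = t * A + s * B by field.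
  have -> : (f x + (t / (s + t) * dotp xi y1 + s / (s + t) * dotp xi y2)) * (s + t) =
    f x * (s + t) + t * dotp xi y1 + s * dotp xi y2 by field.
  by move=> ?; lra.
pose A : set R := [set z | exists y s, [/\ supported k y, 0 < s &
   z = (f x + dotp xi y - f (x + y - s *: e)) / s]].
have s0 : supported k 0 by move=> i _; rewrite mxE.
have hA : has_sup A.
  split; first by exists ((f x + dotp xi 0 - f (x + 0 - 1 *: e)) / 1), 0, 1; split.
  exists ((f (x + 0 + 1 *: e) - f x - dotp xi 0) / 1) => _ [y [s [hy s1 ->]]].
  exact: key.
pose alpha := sup A.
have lo y s : supported k y -> 0 < s -> (f x + dotp xi y - f (x + y - s *: e)) / s <= alpha.
  by move=> hy hs; apply: ub_le_sup; [case: hA|exists y, s].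
have hi y t : supported k y -> 0 < t -> alpha <= (f (x + y + t *: e) - f x - dotp xi y) / t.
  by move=> hy ht; apply: ge_sup; [case: hA|move=> _ [y' [s [hy' hs ->]]]; exact: key].
exists (fun i => if i == i0 then alpha else xi i) => y hy.
pose t := y 0 i0; pose y' := y - t *: e.
have hy' : supported k y'.
  move=> i; rewrite leq_eqVlt => /orP[/eqP ki|ki].
    have -> : i = i0 by apply: val_inj; rewrite /= ki.
    by rewrite !mxE eqxx /= eqxx mulr1 subrr.
  rewrite !mxE hy//= (_ : (i == i0) = false) ?andbF ?mulr0 ?subrr//.
  by apply/eqP => ii; rewrite ii/= ltnn in ki.
have yE : y = y' + t *: e by rewrite /y' subrK.
have dE : dotp (fun i => if i == i0 then alpha else xi i) y = dotp xi y' + t * alpha.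
  rewrite /dotp (bigD1 i0)//= eqxx [in RHS](bigD1 i0)//= hy'// mulr0 add0r.
  rewrite mulrC addrC; congr (_ + _); apply: eq_bigr => i ii.
  rewrite (negbTE ii) !mxE (negbTE ii) andbF mulr0 subr0//.
rewrite dE [X in f (x + X)]yE (addrA x); have [t0|t0|t0] := ltgtP t 0.
- have := lo y' (- t) hy'; rewrite oppr_gt0 => /(_ t0).
  rewrite scaleNr opprK ler_pdivrMr ?oppr_gt0// => h; lra.
- have := hi y' t hy' t0; rewrite ler_pdivlMr// => h; lra.
- by rewrite t0 scale0r mul0r !addr0; exact: H.
Qed.

Lemma subgradient_exists x : exists xi : 'I_d -> R, forall y, f x + dotp xi (y - x) <= f y.
Proof.
have H k : exists xi : 'I_d -> R, forall y, supported k y -> f x + dotp xi y <= f (x + y).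
  elim: k => [|k [xi ih]]; last exact: subgradient_step ih.
  exists (fun=> 0) => y hy; have -> : y = 0 by apply/rowP => i; rewrite mxE hy.
  by rewrite /dotp big1 ?addr0// => i _; rewrite mul0r.
have [xi hxi] := H d; exists xi => y.
have := hxi (y - x); rewrite subrKC; apply => i di; exfalso.
by have := ltn_ord i; rewrite ltnNge di.
Qed.

End subgradient.

Section degenerate.
Context {R : realType} {d : nat}.
Implicit Types (f : 'rV[R]_d -> R).

(** One slope [s] serves all lines parallel to [v]; hence [f] minus a suitable linear form factors
    through the quotient by [v]. *)
Definition affine_along f (v : 'rV[R]_d) : Prop :=
  exists s, forall x t, f (x + t *: v) = f x + t * s.

Definition degenerate f : Prop := exists2 v, v != 0 & affine_along f v.

(** The subgradient inequalities at [x] and at [x + t *: v] bound the same increment from below and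
    from above. *)
Lemma subgradients_affine f (sg : 'rV[R]_d -> 'I_d -> R) v :
  (forall x y, f x + dotp (sg x) (y - x) <= f y) ->
  (forall x y, dotp (sg x) v = dotp (sg y) v) -> affine_along f v.
Proof.
move=> sgP same; exists (dotp (sg 0) v) => x t.
apply/eqP; rewrite eq_le; apply/andP; split.
  have := sgP (x + t *: v) x.
  by rewrite opprD addNKr dotpN dotpZ (same _ 0); lra.
have := sgP x (x + t *: v).
by rewrite addrAC subrr add0r dotpZ (same _ 0); lra.
Qed.

Lemma dotp_sum (X : seq 'rV[R]_d) (sg : 'rV[R]_d -> 'I_d -> R) v :
  dotp (fun i => \sum_(x <- X) sg x i) v = \sum_(x <- X) dotp (sg x) v.
Proof. by rewrite /dotp exchange_big; apply: eq_bigr => i _; rewrite mulr_suml. Qed.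

Lemma compact_unit_sphere : compact [set v : 'rV[R]_d | `|v| = 1].
Proof.
apply: bounded_closed_compact.
  exists 1; split; first exact: num_real.
  by move=> M M1 v /= ->; exact: ltW.
rewrite (_ : mkset _ = (fun v : 'rV[R]_d => `|v|) @^-1` [set 1]) //.
apply: preimage_closed; last exact: closed_eq.
by move=> v _; exact: norm_continuous.
Qed.

(** After centring at the mean, the finitely many slopes in a direction [v] sum to zero without all
    vanishing. By compactness of the sphere one of them is at least a fixed multiple of [|v|], and
    its support plane forces linear growth. *)
Lemma nondegenerate_coercive f : (0 < d)%N -> convex_function setT f -> ~ degenerate f ->
  exists l : 'I_d -> R, coercive (fun x => f x - dotp l x).
Proof.
move=> d0 fc nd.
have /choice[sg sgP] := subgradient_exists fc.
have sep v : v != 0 -> exists x y, dotp (sg x) v != dotp (sg y) v.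
  move=> v0; apply: contrapT => /forallNP H; apply: nd; exists v => //.
  apply: (subgradients_affine sgP) => x y.
  by have /forallNP/(_ y)/negP/negPn/eqP := H x.
have cS := compact_unit_sphere; have := cS; rewrite compact_cover => cov.
have [|v /= v1|D _ cover] := cov ('rV[R]_d * 'rV[R]_d)%type setT
    (fun k => [set v | dotp (sg k.1) v - dotp (sg k.2) v != 0]).
- move=> k _.
  rewrite (_ : mkset _ = (fun v => dotp (sg k.1) v - dotp (sg k.2) v) @^-1` [set y | y != 0]) //.
  apply: open_comp; last exact: open_neq.
  have ct : continuous (fun v : 'rV[R]_d => dotp (sg k.1) v - dotp (sg k.2) v).
    by apply: continuous_sub; exact: dotp_continuous.
  by move=> v _; exact: (ct v).
- have [|x [y xy]] := sep v; first by rewrite -normr_eq0 v1 oner_eq0.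
  by exists (x, y) => //=; rewrite subr_eq0.
pose X := map fst (finmap.enum_fset D) ++ map snd (finmap.enum_fset D).
pose N : R := (size X)%:R.
have sepX v : `|v| = 1 -> exists x y, [/\ x \in X, y \in X & dotp (sg x) v != dotp (sg y) v].
  move=> /cover[[x y] /= kD]; rewrite subr_eq0 => xy; exists x, y; split => //.
    by rewrite mem_cat; apply/orP; left; apply/mapP; exists (x, y).
  by rewrite mem_cat; apply/orP; right; apply/mapP; exists (x, y).
(* The sphere is nonempty because [0 < d]; this makes [X] nonempty, so the mean is defined, and
   provides the minimum of [M]. *)
have [u u1] : exists u : 'rV[R]_d, `|u| = 1.
  exists (`|const_mx 1 : 'rV[R]_d|^-1 *: const_mx 1).
  have c0 : (const_mx 1 : 'rV[R]_d) != 0.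
    apply/eqP => /rowP/(_ (Ordinal d0)); rewrite !mxE => /eqP.
    by rewrite oner_eq0.
  by rewrite normrZ normfV normr_id mulVf// normr_eq0.
have X0 : (0 < size X)%N.
  by have [x [y [+ _ _]]] := sepX u u1; case: (X).
have N0 : 0 < N by rewrite ltr0n.
pose l := (fun i => N^-1 * \sum_(x <- X) sg x i).
have dl v : dotp l v = N^-1 * \sum_(x <- X) dotp (sg x) v.
  rewrite -dotp_sum /dotp mulr_sumr; apply: eq_bigr => i _; rewrite /l mulrA//.
pose a x v := dotp (sg x) v - dotp l v.
have sum0 v : \sum_(x <- X) a x v = 0.
  rewrite /a sumrB dl big_const_seq count_predT iter_addr_0 -mulr_natr.
  by rewrite mulrAC mulVf ?mul1r ?subrr// lt0r_neq0.
pose M v := \sum_(x <- X) `|a x v|.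
have cM : continuous M.
  apply: continuous_sum_norm => x; apply: continuous_sub; exact: dotp_continuous.
have M0 v : `|v| = 1 -> 0 < M v.
  move=> /sepX[x [y [xX yX xy]]]; rewrite lt_neqAle sumr_ge0// andbT eq_sym.
  apply/negP => /eqP Mv.
  have az z : z \in X -> a z v = 0.
    move=> zX; apply/eqP; rewrite -normr_eq0; move/eqP: Mv.
    rewrite /M psumr_eq0// => /allP/(_ z zX); exact.
  have := az x xX; have := az y yX; rewrite /a => h1 h2.
  by move/eqP: xy; apply; lra.
have [|v0 v01 hv0] := compact_EVT_min _ cS (continuous_subspaceT cM); first by exists u.
pose mu := M v0; have mu0 : 0 < mu by apply: M0; move: v01; rewrite inE.
have Mge v : mu * `|v| <= M v.
  have [->|v0'] := eqVneq v 0; first by rewrite normr0 mulr0 sumr_ge0.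
  have nv : 0 < `|v| by rewrite normr_gt0.
  have := hv0 (`|v|^-1 *: v); rewrite inE/= normrZ normfV normr_id mulVf ?gt_eqF// => /(_ erefl).
  have -> : M (`|v|^-1 *: v) = `|v|^-1 * M v.
    rewrite /M mulr_sumr; apply: eq_bigr => x _; rewrite /a !dotpZ -mulrBr normrM.
    by rewrite normfV normr_id.
  by rewrite ler_pdivlMl// mulrC.
have big v : exists2 x, x \in X & M v / (2 * N) <= a x v.
  exact: exists_large_term.
pose C := \sum_(x <- X) `|f x - dotp (sg x) x|.
exists l => B.
exists ((B + C) * (2 * N) / mu) => y; rewrite ltr_pdivrMr// => yB.
have [x xX ax] := big y.
have Cx : - C <= f x - dotp (sg x) x.
  rewrite lerNl; apply: (@le_trans _ _ `|f x - dotp (sg x) x|); first by rewrite -normrN ler_norm.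
  by rewrite /C (big_rem x xX)/= lerDl sumr_ge0.
have := sgP x y; rewrite dotpD dotpN => sx.
have : (B + C) < M y / (2 * N).
  rewrite ltr_pdivlMr ?mulr_gt0//; apply: lt_le_trans yB _.
  by rewrite mulrC; exact: Mge.
by rewrite /a in ax; lra.
Qed.

End degenerate.

(** * The equivalences *)

Section linear_forms.
Context {R : realType} {d : nat}.

Lemma dotp_is_linear (xi : 'I_d -> R) :
  linear_for *%R (dotp xi : 'rV[R]_d -> R^o).
Proof. by move=> k x y; rewrite dotpD dotpZ. Qed.

HB.instance Definition _ (xi : 'I_d -> R) :=
  GRing.isLinear.Build R 'rV[R]_d R *%R (dotp xi : 'rV[R]_d -> R) (dotp_is_linear xi).

Lemma of_class_continuous p (f : 'rV[R]_d -> R) : of_class p f -> continuous f.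
Proof. by case: p => [[|n]|] /=; [case|case|move=> /(_ 0%N)[]]. Qed.

Lemma real_analytic_of_class_succ p (f : 'rV[R]_d -> R) :
  real_analytic f -> of_class_succ p f.
Proof. by case: p => [n|] // fa; exact: real_analytic_C_n. Qed.

End linear_forms.

Section factorization.
Context {R : realType}.

Lemma factor_degenerate d (f : 'rV[R]_d -> R) k (P : {linear 'rV[R]_d -> 'rV[R]_k})
    (c : 'rV[R]_k -> R) (l : {scalar 'rV[R]_d}) :
  (k < d)%N -> (forall x, f x = c (P x) + l x) -> degenerate f.
Proof.
move=> kd fE.
have K0 : kermx (lin1_mx P) != 0.
  rewrite -mxrank_eq0 mxrank_ker -lt0n subn_gt0.
  exact: leq_ltn_trans (rank_leq_col _) kd.
have /rowV0Pn[v /sub_kermxP vK v0] := K0.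
exists v => //; exists (l v) => x t.
have Pv : P v = 0 by rewrite -mul_rV_lin1.
by rewrite !fE !linearD !linearZ /= Pv scaler0 addr0 addrA.
Qed.

Lemma degenerate_factor d (f : 'rV[R]_d -> R) : convex_function setT f -> degenerate f ->
  exists (k : nat) (P : {linear 'rV[R]_d -> 'rV[R]_k}) (c : 'rV[R]_k -> R)
    (l : {scalar 'rV[R]_d}),
  [/\ (k < d)%N, range P = setT, convex_function setT c & forall x, f x = c (P x) + l x].
Proof.
case: d f => [|d] f fc [v v0 [s fs]].
  by exfalso; move/eqP: v0; apply; apply/rowP => -[].
have [i0 vi0] : exists i0, v 0 i0 != 0.
  apply: contrapT => /forallNP H; move/eqP: v0; apply; apply/rowP => i.
  by rewrite mxE; have /negP/negPn/eqP := H i.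
(* [A] projects along [v] onto the hyperplane where the coordinate [i0] vanishes, read in the other
   [d] coordinates; [emb] is the inclusion of that hyperplane. *)
pose A : 'M[R]_(d.+1, d) := \matrix_(i, j)
  ((i == lift i0 j)%:R - (i == i0)%:R * (v 0 (lift i0 j) / v 0 i0)).
have PE (x : 'rV[R]_d.+1) j : (x *m A) 0 j = x 0 (lift i0 j) - x 0 i0 * (v 0 (lift i0 j) / v 0 i0).
  rewrite !mxE (bigD1 i0)//= (bigD1 (lift i0 j))//=; last by rewrite eq_sym neq_lift.
  rewrite big1 ?addr0; last first.
    by move=> i /andP[h1 h2]; rewrite !mxE (negbTE h1) (negbTE h2) mul0r subr0 mulr0.
  rewrite !mxE !eqxx (negbTE (neq_lift i0 j)) eq_sym (negbTE (neq_lift i0 j)).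
  by rewrite mulr0n mulr1n; ring.
pose emb (z : 'rV[R]_d) : 'rV[R]_d.+1 := \row_i (if unlift i0 i is Some j then z 0 j else 0).
have embL z j : emb z 0 (lift i0 j) = z 0 j by rewrite mxE liftK.
have emb0 z : emb z 0 i0 = 0 by rewrite mxE unlift_none.
have embP x : emb (x *m A) = x - (x 0 i0 / v 0 i0) *: v.
  apply/rowP => i; case: (unliftP i0 i) => [j|] ->.
    by rewrite embL PE !mxE; ring.
  by rewrite emb0 !mxE divfK// subrr.
have Pemb z : emb z *m A = z.
  by apply/rowP => j; rewrite PE embL emb0 mul0r subr0.
pose xi i := if i == i0 then s / v 0 i0 else 0.
have xiE x : dotp xi x = x 0 i0 / v 0 i0 * s.
  rewrite /dotp (bigD1 i0)//= /xi eqxx big1 ?addr0; first by ring.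
  by move=> i /negbTE ->; rewrite mul0r.
exists d, (mulmxr A : {linear 'rV[R]_d.+1 -> 'rV[R]_d}), (f \o emb), (dotp xi : {scalar 'rV[R]_d.+1}).
split => //.
- by apply/seteqP; split => // z _; exists (emb z) => //; exact: Pemb.
- apply/convex_function_setT => x y t t01 /=.
  have -> : emb (t *: x + (1 - t) *: y) = t *: emb x + (1 - t) *: emb y.
    apply/rowP => i; rewrite !mxE; case: unliftP => [j _|_]; rewrite ?mxE//.
    by rewrite !mulr0 addr0.
  exact: (iffLR (convex_function_setT f) fc).
- by move=> x /=; rewrite embP xiE -fs subrK.
Qed.

End factorization.

Lemma continuous_inv (R : realType) (T : topologicalType) (f : T -> R) :
  (forall x, f x != 0) -> continuous f -> continuous (fun x => (f x)^-1).
Proof. by move=> f0 cf x; apply: cvgV; [exact: f0|exact: cf]. Qed.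

(** * Rigidity along degenerate directions *)

Section rigidity.
Context {R : realType} {d : nat}.

Lemma degenerate_rigid (f : 'rV[R]_d -> R) (class : set ('rV[R]_d -> R)) :
  degenerate f -> (forall g, class g -> convex_function setT g) ->
  C0_fine_approximable f class -> class f.
Proof.
move=> [v v0 [s fs]] cc H.
pose eps (x : 'rV[R]_d) := (1 + `|x|)^-1.
have eps0 x : 0 < eps x by rewrite invr_gt0 ltr_wpDr.
have ceps : continuous eps.
  have : continuous (fun x : 'rV[R]_d => 1 + `|x|).
    by apply: continuous_add; [exact: cst_continuous|exact: norm_continuous].
  by apply: continuous_inv => x; rewrite gt_eqF// ltr_wpDr.
have [g gc gf] := H eps ceps eps0.
have gcv := iffLR (convex_function_setT g) (cc _ gc).
suff -> : f = g by [].
apply/funext => x; apply/eqP; rewrite -subr_eq0 -normr_le0; apply/ler_addgt0Pr => e e0.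
rewrite add0r.
have nv : 0 < `|v| by rewrite normr_gt0.
pose h t := g (x + t *: v) - f x - t * s.
pose e' := e / 3; have e'0 : 0 < e' by rewrite divr_gt0.
(* Beyond [T] the point [x + t *: v] has norm at least [e'^-1], so [eps] is at most [e'] there. *)
pose T := (e'^-1 + `|x|) / `|v|.
have T0 : 0 < T by rewrite divr_gt0// ltr_wpDr// invr_gt0.
have small t : T <= `|t| -> `|h t| <= e'.
  move=> Tt; have := gf (x + t *: v); rewrite fs -normrN.
  have -> : - (f x + t * s - g (x + t *: v)) = h t by rewrite /h; ring.
  move=> /le_trans; apply; rewrite /eps -[e']invrK lef_pV2 ?posrE ?invr_gt0 ?ltr_wpDr//.
  have : e'^-1 + `|x| <= `|t *: v|.
    by rewrite normrZ -ler_pdivrMr.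
  have : `|t *: v| <= `|x + t *: v| + `|x|.
    have E : t *: v = (x + t *: v) - x by rewrite addrAC subrr add0r.
    by rewrite {1}E ler_normB.
  by lra.
have mid a b : h ((a + b) / 2) * 2 <= h a + h b.
  have t01 : 0 <= (2^-1 : R) <= 1 by apply/andP; split; lra.
  have := gcv (x + a *: v) (x + b *: v) _ t01.
  have -> : 2^-1 *: (x + a *: v) + (1 - 2^-1) *: (x + b *: v) = x + ((a + b) / 2) *: v.
    by apply/rowP => i; rewrite !mxE; field.
  by rewrite /h; lra.
have sT : `|h T| <= e' by apply: small; rewrite gtr0_norm.
have sNT : `|h (- T)| <= e' by apply: small; rewrite normrN gtr0_norm.
have s2T : `|h (2 * T)| <= e'.
  have T2 : 0 < 2 * T by exact: mulr_gt0.
  by apply: small; rewrite (gtr0_norm T2) mulr_natl mulr2n lerDl ltW.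
(* The pair [T], [- T] gives [h 0 <= e'], the pair [0], [2 * T] gives [h 0 >= - 3 * e']; hence the
   third of [e]. *)
have m1 := mid T (- T); have m2 := mid 0 (2 * T).
rewrite subrr mul0r in m1; rewrite add0r mulrAC mulfV ?mul1r ?pnatr_eq0// in m2.
have h0 : f x - g x = - h 0 by rewrite /h scale0r addr0 mul0r; ring.
rewrite h0 normrN ler_norml.
move: sT sNT s2T; rewrite !ler_norml => /andP[? ?] /andP[? ?] /andP[? ?].
have e3 : e = 3 * e' by rewrite /e'; field.
by apply/andP; split; lra.
Qed.

End rigidity.

(** * Proper convexity, coercivity and approximation *)

Section equivalences.
Context {R : realType} {d : nat}.

Lemma coercive_norm_infty (c : 'rV[R]_d -> R) :
  (c x @[x --> norm_infty] --> +oo) <-> coercive c.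
Proof.
split=> [h B|h].
  have [r _ hr] : norm_infty (c @^-1` [set y | B < y]).
    by apply: h; exists B; split; [exact: num_real|].
  by exists r => x xr; exact: hr.
move=> A [B [Br BA]]; have [r hr] := h B.
by exists r => // x xr; apply: BA; exact: hr.
Qed.

(** On the whole space [b] is infinite: properness makes [c] exceed [c 0] somewhere, and convexity
    then makes it grow at least linearly along that ray, past any finite [b]. *)
Lemma properly_convex_coercive (f : 'rV[R]_d -> R) : (0 < d)%N -> properly_convex setT f ->
  exists (l : {scalar 'rV[R]_d}) (c : 'rV[R]_d -> R),
    (forall x, f x = l x + c x) /\ coercive c.
Proof.
move=> d0 [l [c [a [b [ab fE cab cc cK]]]]]; exists l, c; split; first by move=> x; exact: fE.
have ca x : a <= c x by have [] := cab x I.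
have bnd B : a <= B -> (B%:E < b)%E -> exists r, forall x, r < `|x| -> B < c x.
  move=> aB Bb; have := compact_bounded (cK B aB Bb) => -[r [_ hr]].
  exists (r + 1) => x xr; rewrite ltNge; apply/negP => cB.
  have := hr ((r + `|x|) / 2) _ x; rewrite /= => hh.
  have : `|x| <= (r + `|x|) / 2.
    by apply: hh; [lra|split => //; rewrite /= ca cB].
  by lra.
case: b ab cab cK bnd => [b| |] ab cab cK bnd; last by [].
- exfalso; have [|r hr] := bnd (c 0) (ca 0); first by have [] := cab 0 I.
  have c1 : 0 < `|const_mx 1 : 'rV[R]_d|.
    rewrite normr_gt0; apply/eqP => /rowP/(_ (Ordinal d0)); rewrite !mxE => /eqP.
    by rewrite oner_eq0.
  pose x1 : 'rV[R]_d := ((`|r| + 1) / `|const_mx 1 : 'rV[R]_d|) *: const_mx 1.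
  have x1r : r < `|x1|.
    rewrite normrZ ger0_norm ?divr_ge0 ?(ltW c1) ?addr_ge0// divfK ?gt_eqF//.
    by have := ler_norm r; lra.
  have c01 := hr x1 x1r.
  have gcv := iffLR (convex_function_setT c) cc.
  have grow (n : R) : 1 <= n -> c 0 + n * (c x1 - c 0) <= c (n *: x1).
    move=> n1; have n0 : 0 < n by lra.
    have t01 : 0 <= n^-1 <= 1 by rewrite invr_ge0 ltW//= invf_le1.
    have := gcv (n *: x1) 0 _ t01.
    rewrite scalerA mulVf ?gt_eqF// scale1r scaler0 addr0 => q.
    have := ler_wpM2l (ltW n0) q.
    rewrite mulrDr !mulrA mulfV ?gt_eqF// mul1r mulrBr mulr1 mulfV ?gt_eqF//.
    by lra.
  have cb x' : c x' < b by have [_] := cab x' I; rewrite lte_fin.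
  pose n := 1 + (b - c 0) / (c x1 - c 0).
  have D0 : 0 < c x1 - c 0 by lra.
  have n1 : 1 <= n by rewrite lerDl divr_ge0 ?(ltW D0)// subr_ge0 ltW.
  have := grow n n1; rewrite /n mulrDl mul1r divfK ?gt_eqF//.
  by have := cb (n *: x1); rewrite /n; lra.
- move=> B; have aB : a <= Num.max a B by rewrite le_max lexx.
  have [r hr] := bnd _ aB (ltry _).
  by exists r => x /hr; rewrite gt_max => /andP[].
Qed.

Lemma coercive_lower_bound (c : 'rV[R]_d -> R) : continuous c -> coercive c ->
  exists m, forall x, m <= c x.
Proof.
move=> cc co; have cK := compact_sublevel (B := 0) cc co.
have [K0|nK] := pselect ([set x | c x <= 0] !=set0); last first.
  by exists 0 => x; rewrite leNgt; apply/negP => cx; apply: nK; exists x; exact: ltW.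
have [x _ hx] := compact_EVT_min K0 cK (continuous_subspaceT cc).
exists (Num.min 0 (c x)) => y; rewrite ge_min; have [cy|cy] := leP (c y) 0.
  by rewrite hx ?orbT// inE.
by rewrite ltW.
Qed.

Lemma coercive_properly_convex (f : 'rV[R]_d -> R) (l : 'I_d -> R) :
  continuous f -> convex_function setT f -> coercive (fun x => f x - dotp l x) ->
  properly_convex setT f.
Proof.
move=> cf fc co; pose c x := f x - dotp l x.
have cc : continuous c by apply: continuous_sub => //; exact: dotp_continuous.
have [m hm] := coercive_lower_bound cc co.
exists (dotp l : {scalar 'rV[R]_d}), c, m, +oo%E; split.
- by rewrite ltry.
- by move=> x _; rewrite /c /= subrKC.
- by move=> x _; rewrite ltry; split => //; exact: hm.
- apply/convex_function_setT => x y t t01.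
  have := iffLR (convex_function_setT f) fc x y t t01.
  by rewrite /c dotpD !dotpZ; lra.
- move=> B mB _; rewrite setTI (_ : _ @^-1` _ = [set x | c x <= B]).
    exact: compact_sublevel.
  by apply/seteqP; split => x /=; [move=> /andP[]|rewrite hm].
Qed.

Lemma coercive_not_degenerate (f : 'rV[R]_d -> R) (l : {scalar 'rV[R]_d}) (c : 'rV[R]_d -> R) :
  (forall x, f x = l x + c x) -> coercive c -> ~ degenerate f.
Proof.
move=> fE co [v v0 [s fs]].
have cl t : c (t *: v) = c 0 + t * (s - l v).
  have := fs 0 t; rewrite add0r !fE linear0 linearZ /=; lra.
have [r hr] := co (c 0).
have nv : 0 < `|v| by rewrite normr_gt0.
pose T := (`|r| + 1) / `|v|.
have T0 : 0 < T by rewrite divr_gt0// ltr_wpDl.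
have big t : `|t| = T -> c 0 < c (t *: v).
  move=> tT; apply: hr; rewrite normrZ tT /T divfK ?gt_eqF//.
  by have := ler_norm r; lra.
have := big T; have := big (- T); rewrite normrN gtr0_norm// !cl.
by move=> /(_ erefl) h1 /(_ erefl) h2; lra.
Qed.

Lemma coercive_approximable (f : 'rV[R]_d -> R) (l : 'I_d -> R) :
  continuous f -> convex_function setT f -> coercive (fun x => f x - dotp l x) ->
  C0_fine_approximable f [set g | strongly_convex g /\ real_analytic g].
Proof.
move=> cf fc co eps ceps eps0; pose c x := f x - dotp l x.
have cc : continuous c by apply: continuous_sub => //; exact: dotp_continuous.
have [m hm] := coercive_lower_bound cc co.
have ccm : continuous (fun x => c x - m).
  by apply: continuous_sub => //; exact: cst_continuous.
have com : coercive (fun x => c x - m).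
  by move=> B; have [r hr] := co (B + m); exists r => x /hr; rewrite /c; lra.
have cvm : convex_function setT (fun x => c x - m).
  apply/convex_function_setT => x y t t01.
  have := iffLR (convex_function_setT f) fc x y t t01.
  by rewrite /c dotpD !dotpZ; lra.
have /choice[sg sgP] := subgradient_exists cvm.
have cm0 x : 0 <= c x - m by rewrite subr_ge0.
have [g [g1 g2 gf]] := analytic_fine_approximation l m ccm com cm0 ceps eps0 sgP.
exists g => // x; have := gf x; rewrite /c.
by rewrite (_ : f x - dotp l x - m + dotp l x + m = f x)//; ring.
Qed.

End equivalences.

Theorem theorem4 (R : realType) (d : nat) (hd : (2 <= d)%N) (p : exponent)
    (f : 'rV[R]_d -> R) (f_class : of_class p f)
    (f_convex : convex_function setT f) (f_not_succ : ~ of_class_succ p f) :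
  [<-> (* 1 *) properly_convex setT f;
       (* 2 *) exists (l : {scalar 'rV[R]_d}) (c : 'rV[R]_d -> R),
         (forall x, f x = l x + c x) /\ c x @[x --> norm_infty] --> +oo%R;
       (* 3 *) ~ exists (k : nat) (P : {linear 'rV[R]_d -> 'rV[R]_k})
                   (c : 'rV[R]_k -> R) (l : {scalar 'rV[R]_d}),
         [/\ (k < d)%N, range P = setT, convex_function setT c
           & forall x, f x = c (P x) + l x];
       (* 4 *) C0_fine_approximable f
         [set g | strongly_convex g /\ real_analytic g];
       (* 5 *) C0_fine_approximable f
         [set g | of_class_succ p g /\ convex_function setT g]].
Proof.
have cf := of_class_continuous f_class.
have d0 : (0 < d)%N by exact: ltn_trans hd.
tfae.
- move=> /(properly_convex_coercive d0)[l [c [fE co]]].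
  by exists l, c; split => //; exact/coercive_norm_infty.
- move=> [l [c [fE /coercive_norm_infty co]]] [k [P [c' [l' [kd _ _ fE']]]]].
  exact: coercive_not_degenerate fE co (factor_degenerate kd fE').
- move=> nf; have nd : ~ degenerate f by move=> /(degenerate_factor f_convex).
  have [l co] := nondegenerate_coercive d0 f_convex nd.
  exact: coercive_approximable co.
- move=> H eps ceps eps0; have [g [g1 g2] gf] := H eps ceps eps0.
  exists g => //; split; first exact: real_analytic_of_class_succ.
  exact: strongly_convex_convex.
(* In a degenerate direction the only possible approximant is [f], which would then have class
   C^{p+1}, against [f_not_succ]. *)
- move=> H; have nd : ~ degenerate f.
    move=> df; apply: f_not_succ.
    by have [] := degenerate_rigid df _ H; [move=> g []|].
  have [l co] := nondegenerate_coercive d0 f_convex nd.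
  exact: coercive_properly_convex co.
Qed.
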